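(* Let $(X,X_* )$ be a dual pairing and let ${\bf T}=(T(t))_{t>0}\subset\mathcal B_w(X)$ be a semigroup which is weakly continuous with respect to $(X,X_* )$. Let $S=S_{u/v}\in\mathcal{QM}(\mathcal I_{\bf T})$, where $u\in\mathcal I_{\bf T}$, $v\in\Omega(\mathcal I_{\bf T})$. Set $\mathcal D_{\tilde S}:=\{x\in X_1 : ux\in v(\tilde X)\}$, and for $x\in\mathcal D_{\tilde S}$ denote by $\tilde S(x)$ the unique $y\in\tilde X$ satisfying $ux=vy$. Then $\mathcal D_{\tilde S}$ is weakly dense in $X_1$. If $\limsup_{t\to0^+}\|T(t)\|<+\infty$, then $\tilde S$ is a closed partially defined operator on $X_1$, and $\tilde S$ is weakly closed if, further, the $\sigma(X_*,X)$-closed convex hull of every $\sigma(X_*,X)$-compact subset of $X_*$ is $\sigma(X_*,X)$-compact.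
   Context: Dual pairing $(X,X_* )$: $X$ is a Banach space, $X_*$ a linear subspace of the dual $X'$ such that (1) $\|x\|=\sup\{|\langle x,l\rangle| : l\in X_*,\|l\|\le1\}$ for all $x\in X$; (2) the $\sigma(X,X_* )$-closed convex hull of every $\sigma(X,X_* )$-compact subset of $X$ is $\sigma(X,X_* )$-compact. $\mathcal B_w(X)$ is the set of $R\in\mathcal B(X)$ with $l\circ R\in X_*$ for all $l\in X_*$. A semigroup ${\bf T}=(T(t))_{t>0}\subset\mathcal B_w(X)$ ($T(s+t)=T(s)T(t)$) is weakly continuous with respect to $(X,X_* )$ if $t\mapsto\langle T(t)x,l\rangle$ is continuous on $(0,+\infty)$ for all $x\in X,l\in X_*$. ''Weakly'' (dense, closed) refers to the topology $\sigma(X,X_* )$; a partially defined operator is closed (weakly closed) if its graph is closed in $X_1\times X_1$ for the norm (weak) topology. $X_1$ is the norm closure of $\bigcup_{t>0}T(t)(X)$, and $\tilde X=\{x\in X_1 : \lim_{t\to0^+}\langle T(t)x-x,l\rangle=0\ \forall l\in X_*\}$. $L^1_{\omega_{\bf T}}$ is the convolution algebra of measurable $f$ on $(0,+\infty)$ with $\int_0^{+\infty}|f(t)|\,\|T(t)\|dt<+\infty$; for such $f$, $\phi_{\bf T}(f)\in\mathcal B(X)$ is determined by $\langle\phi_{\bf T}(f)x,l\rangle=\int_0^{+\infty}f(t)\langle T(t)x,l\rangle dt$ and is regarded as an element of $\mathcal B(X_1)$. The Arveson ideal $\mathcal I_{\bf T}$ is the operator-norm closure of $\phi_{\bf T}(L^1_{\omega_{\bf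 T}})$ in $\mathcal B(X_1)$, a commutative Banach algebra. $\Omega(\mathcal I_{\bf T})=\{v\in\mathcal I_{\bf T} : v\,\mathcal I_{\bf T}\text{ dense in }\mathcal I_{\bf T}\}$ (a nonempty set), and $\mathcal{QM}(\mathcal I_{\bf T})$ is the algebra of quasimultipliers $S_{u/v}$, $u\in\mathcal I_{\bf T}$, $v\in\Omega(\mathcal I_{\bf T})$, i.e. of the partially defined operators on $\mathcal I_{\bf T}$ with domain $\{w : uw\in v\,\mathcal I_{\bf T}\}$ sending $w$ to the unique $w'\in\mathcal I_{\bf T}$ with $uw=vw'$. Each $v\in\Omega(\mathcal I_{\bf T})$ is one-to-one on $\tilde X$. *)

(* Defs.v *)
From HB Require Import structures.
From mathcomp Require Export all_boot all_order all_algebra.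
From mathcomp Require Export complex.
From mathcomp Require Export all_classical all_reals all_analysis.
Export numFieldNormedType.Exports.

Set Implicit Arguments.
Unset Strict Implicit.
Unset Printing Implicit Defensive.

Import Order.TTheory GRing.Theory Num.Theory.

Local Open Scope classical_set_scope.
Local Open Scope complex_scope.
Local Open Scope ring_scope.

(* Banach spaces are complex: [X : completeNormedModType R[i]].  The norm of
   the library takes its values in [R[i]]; [nrm] is the same norm, seen as a
   real number. *)
Definition nrm (R : realType) (V : normedModType R[i]) (x : V) : R :=
  complex.Re `|x|.

Section operators.
Context (R : realType).
Local Notation C := R[i].

Definition opnorm (V W : normedModType C) (E : set V) (A : V -> W) : R :=
  sup [set nrm (A x) | x in [set x | E x /\ nrm x <= 1]].

Context (X : normedModType C).

(* B(E), for a linear subspace E of X.  An operator on E is represented by its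
   extension by 0 to X, so that equality in B(E) is equality of functions. *)
Definition bounded_operators (E : set X) : set (X -> X) := [set A |
  [/\ forall x, E x -> E (A x),
      forall (a : C) x y, E x -> E y -> A (a *: x + y) = a *: A x + A y,
      exists M : R, forall x, E x -> nrm (A x) <= M * nrm x &
      forall x, ~ E x -> A x = 0]].

Definition opnorm_closure (E : set X) (F : set (X -> X)) : set (X -> X) :=
  [set A | bounded_operators E A /\
    forall e : R, 0 < e -> exists2 B, F B & opnorm E (A \- B) < e].

(* Graphs of linear operators defined on a linear subspace of E, with values
   in E. *)
Definition partial_operator (E : set X) (G : set (X * X)) : Prop :=
  [/\ G `<=` E `*` E,
      G (0, 0),
      forall (a : C) p q, G p -> G q -> G (a *: p + q) &
      forall x y y', G (x, y) -> G (x, y') -> y = y'].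

End operators.

Definition closed_in (W : topologicalType) (E G : set W) : Prop :=
  E `&` closure G `<=` G.

(* The smallest convex relatively closed subset of E containing K. *)
Definition closed_convex_hull (K : numDomainType) (M : preTopologicalLmodType K)
    (E A : set M) : set M :=
  \bigcap_(H in [set H : set M |
    [/\ A `<=` H, H `<=` E, convex_set H & closed_in E H]]) H.

Definition compact_hull_property (K : numDomainType)
    (M : preTopologicalLmodType K) (E : set M) : Prop :=
  forall A : set M, A `<=` E -> compact A -> compact (closed_convex_hull E A).

(* Functionals on X with the topology of pointwise convergence: on Xs it
   induces sigma(Xs, X). *)
Definition functional (R : realType) (X : normedModType R[i]) : Type :=
  X -> R[i]^o.
HB.instance Definition _ (R : realType) (X : normedModType R[i]) :=
  GRing.Lmodule.copy (functional X) (X -> R[i]^o).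
HB.instance Definition _ (R : realType) (X : normedModType R[i]) :=
  Topological.copy (functional X) {ptws X -> R[i]^o}.

(* X with the topology sigma(X, Xs). *)
Definition weak (R : realType) (X : normedModType R[i])
  (Xs : set (functional X)) : Type := X.
HB.instance Definition _ (R : realType) (X : normedModType R[i])
  (Xs : set (functional X)) := GRing.Lmodule.copy (weak Xs) X.
HB.instance Definition _ (R : realType) (X : normedModType R[i])
  (Xs : set (functional X)) := Topological.copy (weak Xs)
    (initial_topology
      (fun (x : X) => (fun l : set_type Xs => sval l x)
                      : {ptws set_type Xs -> R[i]^o})).

Section dual_pairing.
Context (R : realType) (X : completeNormedModType R[i]).
Local Notation C := R[i].

Record dual_pairing (Xs : set (functional X)) : Prop := {
  dual_pairing_sub : forall l : X -> C^o, Xs l -> linear l /\ continuous l ;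
  dual_pairing0 : Xs 0 ;
  dual_pairingP : forall (a : C) l m, Xs l -> Xs m -> Xs (a *: l + m) ;
  dual_pairing_norm : forall x : X,
    nrm x = sup [set nrm ((l : X -> C^o) x) |
                 l in [set l | Xs l /\ opnorm setT (l : X -> C^o) <= 1]] ;
  dual_pairing_hull : compact_hull_property [set: weak Xs]
}.

Definition weak_bounded_operators (Xs : set (functional X)) : set (X -> X) :=
  [set A | bounded_operators setT A /\ forall l, Xs l -> Xs (l \o A)].

(* T is only constrained at positive times. *)
Record weak_semigroup (Xs : set (functional X)) (T : R -> X -> X) : Prop := {
  weak_semigroup_bounded : forall t, 0 < t -> weak_bounded_operators Xs (T t) ;
  weak_semigroupD : forall s t, 0 < s -> 0 < t -> T (s + t) = T s \o T t ;
  weak_semigroup_continuous : forall (x : X) (l : X -> C^o), Xs l ->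
    {in `]0, +oo[, continuous (fun t : R => l (T t x))}
}.

Context (Xs : set (functional X)) (T : R -> X -> X).

Definition X1 : set X := closure (\bigcup_(t in `]0, +oo[) range (T t)).

Definition Xtilde : set X := [set x | X1 x /\
  forall l : X -> C^o, Xs l -> (fun t : R => l (T t x - x)) @ 0^'+ --> (0 : C^o)].

Definition cmeasurable_fun (D : set R) (f : R -> C) : Prop :=
  measurable_fun D (fun t => complex.Re (f t)) /\
  measurable_fun D (fun t => complex.Im (f t)).

Definition cintegral (D : set R) (f : R -> C) : C :=
  (\int[lebesgue_measure]_(t in D) complex.Re (f t)) +i*
  (\int[lebesgue_measure]_(t in D) complex.Im (f t)).

(* L^1_{omega_T}, where omega_T(t) = ||T(t)||. *)
Definition L1omega : set (R -> C) := [set f | cmeasurable_fun `]0, +oo[ f /\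
  (\int[lebesgue_measure]_(t in `]0%R, +oo[)
    (nrm (f t : C^o) * opnorm setT (T t))%:E < +oo)%E].

(* A = phi_T(f); A is unique by [dual_pairing_norm]. *)
Definition is_phi (f : R -> C) (A : X -> X) : Prop :=
  bounded_operators setT A /\
  forall (x : X) (l : X -> C^o), Xs l ->
    l (A x) = cintegral `]0, +oo[ (fun t => f t * l (T t x)).

(* phi_T(L^1_{omega_T}), regarded as a subset of B(X_1). *)
Definition phi_image : set (X -> X) :=
  [set patch (fun=> 0) X1 A | A in [set A | exists2 f, L1omega f & is_phi f A]].

Definition Arveson_ideal : set (X -> X) := opnorm_closure X1 phi_image.

Definition Omega : set (X -> X) := [set v | Arveson_ideal v /\
  Arveson_ideal `<=` opnorm_closure X1 [set v \o w | w in Arveson_ideal]].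

(* Graph of the quasimultiplier S_{u/v}. *)
Definition quasimultiplier (u v : X -> X) : set ((X -> X) * (X -> X)) :=
  [set p | [/\ Arveson_ideal p.1, Arveson_ideal p.2 & u \o p.1 = v \o p.2]].

Definition QM : set (set ((X -> X) * (X -> X))) := [set S |
  exists u v, [/\ Arveson_ideal u, Omega v & S = quasimultiplier u v]].

Definition dom_tilde (u v : X -> X) : set X :=
  [set x | X1 x /\ (v @` Xtilde) (u x)].

Definition graph_tilde (u v : X -> X) : set (X * X) :=
  [set p | [/\ dom_tilde u v p.1, Xtilde p.2 & u p.1 = v p.2]].

End dual_pairing.

(* Main.v *)
(* The function w(t) = ||T(t)|| is finite and lower semicontinuous on ]0, +oo[,
   so by Baire's theorem it is bounded on some interval inside every ]0, d[.  On
   such an interval the averages phi(1_]a,b]) exist as Pettis integrals, because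
   the weakly closed convex hull of an arc of an orbit is weakly compact, and
   they belong to the Arveson ideal.  Fubini's theorem makes this ideal
   commutative on X1.

   If v y = 0 with v in Omega, every element of the ideal kills y, since it is
   a limit of products v b = b v; in particular the averages of the orbit of y
   vanish, hence T(t) y = 0 for all t > 0, and y = 0 if y is in Xtilde.  The
   domain of Stilde contains v T(a) X1, and T(t) x is a weak limit of averages
   phi(1_]c,d]) T(t - c) x / (d - c), which are norm limits of elements
   v T(a) z.

   If w is bounded near 0 then Xtilde = X1, so that the graph of Stilde is
   {(x, y) | u x = v y}, which is norm closed.  It is weakly closed when the
   functionals l o u o T(s) belong to Xs: the hull property of Xs makes Xs norm
   closed, and puts in Xs the Pettis integrals l o phi(f) for suitably truncated
   f, whose norm limits include the l o u o T(s). *)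
From HB Require Import structures.
Require Import Defs.
From mathcomp Require Import measurable_realfun.
From mathcomp Require Import ring lra.

Set Implicit Arguments.
Unset Strict Implicit.
Unset Printing Implicit Defensive.

Import Order.TTheory GRing.Theory Num.Theory.

Local Open Scope classical_set_scope.
Local Open Scope complex_scope.
Local Open Scope ring_scope.

Local Notation Re := complex.Re.
Local Notation Im := complex.Im.

(** * Real-valued norms *)

(** Everything is reduced to scalars. An equality in [X] is tested on [Xs], which separates points,
    and a bound on the functionals of norm at most 1, which are norming. An operator [T s] can be
    moved onto the functional because [l \o T s] stays in [Xs]; this turns products of operators
    into iterated integrals.

    The obstacle is that Baire's theorem bounds [w] only on some intervals, possibly far from a
    given time [t]. The semigroup law makes this enough: with [c < t] in such an interval,
    [T t = T (t - c) \o T c], so that averages taken just after [c] control the orbit at [t].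

    The Arveson ideal is a closure in B(X1), and its elements vanish outside [X1]. Identities known
    for the operators [phi(f)] therefore pass to the ideal on [X1] only, and each vector to which
    [u] or [v] is applied has to be placed in [X1] beforehand, usually by means of some [T s]. *)

Section real_norm.
Context {R : realType}.
Local Notation C := R[i].

Section normed_module.
Context {V : normedModType C}.
Implicit Types (x y : V).

Lemma nrmE x : `|x| = (nrm x)%:C.
Proof. by rewrite /nrm RRe_real // realE normr_ge0. Qed.

Lemma nrm_ge0 x : 0 <= nrm x.
Proof. by rewrite -ler0c -nrmE. Qed.

Lemma nrm0 : nrm (0 : V) = 0.
Proof. by rewrite /nrm normr0. Qed.

Lemma nrm0_eq0 x : nrm x = 0 -> x = 0.
Proof. by move=> x0; apply/normr0_eq0; rewrite nrmE x0. Qed.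

Lemma nrmD x y : nrm (x + y) <= nrm x + nrm y.
Proof. by rewrite -lecR rmorphD /= -!nrmE ler_normD. Qed.

Lemma nrmN x : nrm (- x) = nrm x.
Proof. by rewrite /nrm normrN. Qed.

Lemma nrmB x y : nrm (x - y) = nrm (y - x).
Proof. by rewrite -nrmN opprB. Qed.

Lemma nrmZ (a : C) x : nrm (a *: x) = nrm (a : C^o) * nrm x.
Proof. by apply: complexI; rewrite rmorphM /= -!nrmE normrZ. Qed.

Lemma nrm_triangle x y z : nrm (x - z) <= nrm (x - y) + nrm (y - z).
Proof. by rewrite -[x - z](subrKA y) nrmD. Qed.

Lemma nbhs_nrmP x (A : set V) :
  nbhs x A <-> exists2 e : R, 0 < e & forall y, nrm (y - x) < e -> A y.
Proof.
rewrite -nbhs_ballE; split=> [[e /= e0 xA]|[e e0 xA]].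
  have eE : e = (Re e)%:C by rewrite RRe_real // realE ltW.
  exists (Re e); first by rewrite -ltcR -eE.
  move=> y yx; apply: xA; rewrite -ball_normE /= nrmE eE ltcR.
  by rewrite nrmB.
exists e%:C => /=; first by rewrite ltcR.
by move=> y; rewrite -ball_normE /= nrmE ltcR nrmB => /xA.
Qed.

Lemma closure_nrmP (A : set V) x :
  closure A x <-> forall e : R, 0 < e -> exists2 y, A y & nrm (y - x) < e.
Proof.
split=> [Ax e e0|Ax B /nbhs_nrmP[e e0 eB]].
  have [|y [Ay /= ye]] := Ax [set y | nrm (y - x) < e]; last by exists y.
  by apply/nbhs_nrmP; exists e.
by have [y Ay /eB By] := Ax e e0; exists y.
Qed.

Lemma cvg_nrmP (T : Type) (F : set_system T) {FF : Filter F} (f : T -> V) x :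
  f @ F --> x <-> forall e : R, 0 < e -> \forall t \near F, nrm (f t - x) < e.
Proof.
split=> [fx e e0|fx B /nbhs_nrmP[e e0 eB]].
  by apply: (fx [set y | nrm (y - x) < e]); apply/nbhs_nrmP; exists e.
by apply: filterS (fx e e0) => t /= /eB.
Qed.

End normed_module.

Lemma nrmM (a b : C^o) : nrm (a * b : C^o) = nrm a * nrm b.
Proof. exact: (@nrmZ C^o). Qed.

Lemma nrm_real (r : R) : nrm (r%:C : C^o) = `|r|.
Proof. by rewrite /nrm normc_def /= expr0n addr0 sqrtr_sqr. Qed.

Lemma normr_Re_le (z : C^o) : `|Re z| <= nrm z.
Proof. by rewrite -lecR -nrmE; exact: normc_ge_Re. Qed.

Lemma normr_Im_le (z : C^o) : `|Im z| <= nrm z.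
Proof.
rewrite -normrN -ReiNIm; apply: (le_trans (normr_Re_le _)).
by rewrite (nrmM z) [X in _ * X]/nrm normc_def /= expr0n expr1n add0r sqrtr1 mulr1.
Qed.

Lemma nrm_le_ReIm (z : C^o) : nrm z <= `|Re z| + `|Im z|.
Proof.
rewrite [X in nrm X]complexE (le_trans (nrmD _ _)) // nrm_real lerD //.
rewrite (nrmM 'i%C) nrm_real [X in X * _]/nrm normc_def /=.
by rewrite expr0n expr1n add0r sqrtr1 mul1r.
Qed.

Lemma cvg_ReIm (T : Type) (F : set_system T) {FF : Filter F} (f : T -> C^o) (z : C^o) :
  f @ F --> z <-> (fun t => Re (f t)) @ F --> Re z /\
                  (fun t => Im (f t)) @ F --> Im z.
Proof.
split=> [/cvg_nrmP fz|[fR fI]].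
  split; apply/cvgrPdist_lt => e e0; apply: filterS (fz e e0) => t;
    apply: le_lt_trans; rewrite distrC -raddfB.
    exact: normr_Re_le.
  exact: normr_Im_le.
apply/cvg_nrmP => e e0.
move/cvgrPdist_lt : fR => /(_ (e / 2)) fR.
move/cvgrPdist_lt : fI => /(_ (e / 2)) fI.
have e2 : 0 < e / 2 by rewrite divr_gt0.
apply: filterS2 (fR e2) (fI e2) => t tR tI.
apply: le_lt_trans (nrm_le_ReIm _) _.
by rewrite [e]splitr !raddfB ltrD // distrC.
Qed.

Lemma complex_eqP (a b : C) : Re a = Re b -> Im a = Im b -> a = b.
Proof. by case: a b => [a1 a2] [b1 b2] /= -> ->. Qed.

Lemma Re_mul (a b : C) : Re (a * b) = Re a * Re b - Im a * Im b.
Proof. by case: a b => [a1 a2] [b1 b2]. Qed.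

Lemma Im_mul (a b : C) : Im (a * b) = Re a * Im b + Im a * Re b.
Proof. by case: a b => [a1 a2] [b1 b2]. Qed.

End real_norm.

(** * Operator norms as real suprema *)

Section operator_norm.
Context {R : realType}.
Local Notation C := R[i].
Context {V W : normedModType C}.

(** The bound by [M] makes the set of norms bounded; otherwise [sup] would be a default value and
    say nothing about [A]. *)
Lemma opnorm_bound (E : set V) (A : V -> W) (M : R) :
  (forall (a : C) x, E x -> E (a *: x)) ->
  (forall (a : C) x, E x -> A (a *: x) = a *: A x) ->
  (forall x, E x -> nrm (A x) <= M * nrm x) ->
  forall x, E x -> nrm (A x) <= opnorm E A * nrm x.
Proof.
move=> EZ AZ AM x Ex; have [x0|x0] := eqVneq (nrm x) 0.
  by have := AM x Ex; rewrite x0 !mulr0.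
have xgt : 0 < nrm x by rewrite lt_neqAle eq_sym x0 nrm_ge0.
pose c : C := ((nrm x)^-1)%:C.
have nc : nrm (c : C^o) = (nrm x)^-1 by rewrite nrm_real ger0_norm // invr_ge0 ltW.
rewrite -ler_pdivrMr // mulrC -nc -nrmZ -AZ //.
apply: ub_le_sup.
  exists `|M| => _ [y [Ey y1] <-]; apply: le_trans (AM y Ey) _.
  apply: (@le_trans _ _ (`|M| * nrm y)); first by rewrite ler_wpM2r ?nrm_ge0 // ler_norm.
  by rewrite -[leRHS]mulr1 ler_wpM2l.
by exists (c *: x) => //; split; [exact: EZ|rewrite nrmZ nc mulVf].
Qed.

Lemma opnorm_le (E : set V) (A : V -> W) (M : R) : E 0 -> 0 <= M ->
  (forall x, E x -> nrm (A x) <= M * nrm x) -> opnorm E A <= M.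
Proof.
move=> E0 M0 AM; apply: ge_sup.
  by exists (nrm (A 0)), 0 => //=; rewrite nrm0.
move=> _ [x [Ex x1] <-]; apply: le_trans (AM x Ex) _.
by rewrite -[leRHS]mulr1 ler_wpM2l.
Qed.

Lemma opnorm_ge0 (E : set V) (A : V -> W) (M : R) : E 0 -> 0 <= M ->
  (forall x, E x -> nrm (A x) <= M * nrm x) -> 0 <= opnorm E A.
Proof.
move=> E0 M0 AM; apply: (@le_trans _ _ (nrm (A 0))); first exact: nrm_ge0.
apply: ub_le_sup; last by exists 0 => //=; rewrite nrm0.
exists M => _ [y [Ey y1] <-]; apply: le_trans (AM y Ey) _.
by rewrite -[leRHS]mulr1 ler_wpM2l.
Qed.

End operator_norm.
(** * Weak topologies and convex hulls *)

Section weak_topologies.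
Context {R : realType}.
Local Notation C := R[i].

Lemma ptws_cvgP (U : Type) (V : topologicalType) (F : set_system (U -> V))
    {FF : Filter F} (f : {ptws U -> V}) :
  F --> f <-> forall u, (fun g : U -> V => g u) @ F --> f u.
Proof.
split=> [fF u|fF].
  move/cvg_sup : fF => /(_ u) fF A fA; apply: fF.
  exact: (@initial_continuous _ _ (fun g : U -> V => g u) f).
apply/cvg_sup => u.
rewrite cvg_image; last by rewrite eqEsubset; split=> v // _; exists (cst v).
move=> W /fF; rewrite nbhs_simpl => FW; exists (@^~ u @^-1` W) => //.
by rewrite eqEsubset; split => [j [? + <-//]|j Wj]; exists (fun _ => j).
Qed.

Section weak.
Context (X : normedModType C) (Xs : set (functional X)).

Lemma cvg_functionalP (I : Type) (F : set_system I) {FF : Filter F}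
    (f : I -> functional X) (m : functional X) :
  f @ F --> m <-> forall x, (fun i => f i x) @ F --> m x.
Proof. exact: (@ptws_cvgP X C^o (f @ F)). Qed.

Lemma cvg_weakP (I : Type) (F : set_system I) {FF : Filter F}
    (f : I -> weak Xs) (x : weak Xs) :
  f @ F --> x <->
  forall l : X -> C^o, Xs l -> (fun i => l (f i : X)) @ F --> l (x : X).
Proof.
pose ev (x : X) : {ptws set_type Xs -> C^o} := fun l => sval l x.
split=> [fx l Xsl|fx].
  have : (ev \o f) @ F --> ev x.
    by apply: cvg_comp fx _; exact: (@initial_continuous _ _ ev).
  move/(@ptws_cvgP _ C^o) => /(_ (SigSub (mem_set Xsl))); exact.
have evf : (ev \o f) @ F --> ev x.
  by apply/(@ptws_cvgP _ C^o) => -[l lXs]; apply: fx; exact: set_mem.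
move=> A [B [[W oW WB] Bx BA]]; apply: filterS BA _.
rewrite -WB; apply: evf; apply: open_nbhs_nbhs; split=> //.
by move: Bx; rewrite -WB.
Qed.

Lemma weak_eval_continuous (l : X -> C^o) : Xs l ->
  continuous (l : weak Xs -> C^o).
Proof. by move=> Xsl x; have /cvg_weakP/(_ l Xsl) := @cvg_id _ (nbhs x). Qed.

Lemma functional_eval_continuous (x : X) :
  continuous (fun l : functional X => l x).
Proof. by move=> l; have /cvg_functionalP/(_ x) := @cvg_id _ (nbhs l). Qed.

End weak.

(** Compactness only provides cluster points. Along [h] the values of [ev] converge, and since the
    scalars are Hausdorff a cluster point has no other value than the limit. *)
Lemma cluster_eval (M : topologicalType) (I : Type) (F : set_system I)
    {FF : Filter F} (h : I -> M) (q : M) (ev : M -> C^o) (z : C^o) :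
  continuous ev -> cluster (h @ F) q -> ev \o h @ F --> z -> ev q = z.
Proof.
move=> cev hq evz; apply: (@norm_hausdorff _ C^o) => A B evA zB.
have [p [hp Ap]] := hq (ev @^-1` B) (ev @^-1` A) (evz _ zB) (cev q _ evA).
by exists (ev p).
Qed.

Section hull.
Context {M : preTopologicalLmodType C}.
Implicit Types (E A H : set M).

(** [convex_set] speaks of two points. The last term is split off and the others are rescaled by
    their total mass [s]; when [s = 0] they all vanish and only the last point remains. *)
Lemma convex_combination H (c : nat -> R) (a : nat -> M) n :
  convex_set H -> (forall i, (i < n)%N -> 0 <= c i) ->
  (forall i, (i < n)%N -> H (a i)) -> \sum_(i < n) c i = 1 ->
  H (\sum_(i < n) (c i)%:C *: a i).
Proof.
move=> cvxH; elim: n c a => [c a _ _|n IH c a c0 Ha].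
  by rewrite big_ord0 => /esym/eqP; rewrite oner_eq0.
rewrite !big_ord_recr /= => cs.
have ci0 : forall i, (i < n)%N -> 0 <= c i by move=> i ni; rewrite c0 // leqW.
have Hai : forall i, (i < n)%N -> H (a i) by move=> i ni; apply: Ha; exact: leqW.
have s0 : 0 <= \sum_(i < n) c i by apply: sumr_ge0 => i _; exact: ci0.
set s := \sum_(i < n) c i in cs s0.
have cnE : c n = 1 - s by rewrite -cs addrAC subrr add0r.
have [sE|sN] := eqVneq s 0.
  have -> : \sum_(i < n) (c i)%:C *: a i = 0.
    apply: big1 => i _; move/eqP : sE; rewrite psumr_eq0; last by move=> j _; exact: ci0.
    by move/allP => /(_ i (mem_index_enum i)) /eqP ->; rewrite scale0r.
  by rewrite add0r cnE sE subr0 scale1r; exact: Ha.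
have sgt : 0 < s by rewrite lt_neqAle eq_sym sN.
have s1 : s <= 1 by rewrite -subr_ge0 -cnE; exact: c0.
have sC : (0 <= (s%:C : C) <= 1) by rewrite ler0c s0 /= (lecR s 1) s1.
have := IH (fun i => s^-1 * c i) a.
have H1 : forall i, (i < n)%N -> 0 <= s^-1 * c i.
  by move=> i ni; rewrite mulr_ge0 ?invr_ge0 // ci0.
move=> /(_ H1 Hai); rewrite -mulr_sumr mulVf // => /(_ erefl) Hs.

pose p : {i01 C} := Itv01 (andP sC).1 (andP sC).2.
have /(_ p) := cvxH (\sum_(i < n) ((s^-1 * c i)%:C : C) *: a i) (a n) _
  (mem_set Hs) (mem_set (Ha n (ltnSn n))).
move=> /set_mem; congr (H (_ + _)).
  rewrite scaler_sumr; apply: eq_bigr => i _; rewrite scalerA; congr (_ *: _).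
  by rewrite -rmorphM /= mulrA mulfV // mul1r.
by congr (_ *: _); rewrite cnE rmorphB.
Qed.

(** A sequence lying in every convex set that contains [A] lies in the closed convex hull of [A], so
    it clusters there by compactness. *)
Lemma hull_cluster E A (h : nat -> M) : convex_set E -> compact_hull_property E ->
  A `<=` E -> compact A ->
  (forall n H, A `<=` H -> convex_set H -> H (h n)) ->
  exists2 q, E q & cluster (h @ \oo) q.
Proof.
move=> cvxE hullE AE cA hH.
have [|q [hq qcl]] := hullE A AE cA (h @ \oo) _.
  by exists 0%N => // n _ H [AH _ cvxH _]; exact: hH.
(* [E] is one of the sets whose intersection is the hull, so the hull lies in [E]. *)
exists q => //; apply: hq; split=> //.
by move=> x [].
Qed.

End hull.
End weak_topologies.
(** * Pettis integrals *)

Section riemann_sums.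
Context {R : realType}.
Local Notation C := R[i].
Local Notation mu := (@lebesgue_measure R).

Lemma compact_uniform_continuity (K : set R) (phi : R -> R) (e : R) :
  compact K -> continuous phi -> 0 < e ->
  exists2 d : R, 0 < d & forall x, K x -> forall s, `|s - x| < d ->
    `|phi s - phi x| < e.
Proof.
move=> cK cphi e0.
pose P (d x : R) := forall s, `|s - x| < d -> `|phi s - phi x| < e.
(* The radius is the parameter of a near-covering argument along [0^'+], by which compactness turns
   local radii into a common one. *)
have [|d [d0 dP]] := @filter_ex _ (0^'+) _ (fun d : R => 0 < d /\ K `<=` P d).
  apply: filterI; first exact: nbhs_right_gt.
  move/compact_near_coveringP : cK => /(_ _ (0^'+) P _); apply => x Kx.
  have e2 : 0 < e / 2 by rewrite divr_gt0.
  have /cvgrPdist_lt/(_ _ e2) := cphi x.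
  rewrite -nbhs_ballE => -[d /= d0 dx].
  have d2 : 0 < d / 2 by rewrite divr_gt0.
  exists (ball x (d / 2), [set r | r < d / 2]) => /=.
    split; first exact: nbhsx_ballx.
    exact: nbhs_right_lt.
  move=> [y r] /= [xy rd] s sy.
  have ys : `|phi x - phi s| < e / 2.
    apply: dx; rewrite /ball /= (le_lt_trans (ler_distD y _ _)) // [d]splitr.
    by rewrite ltrD // distrC (lt_trans sy).
  have yy : `|phi x - phi y| < e / 2.
    apply: dx; rewrite /ball /= (lt_le_trans xy) //.
    by lra.
  by rewrite (le_lt_trans (ler_distD (phi x) _ _)) // [e]splitr ltrD // distrC.
by exists d.
Qed.

(** Index [n] stands for [n.+1] equal steps, so that the step length never has a zero
    denominator. *)
Definition partition_point (a b : R) (n i : nat) : R :=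
  a + i%:R * ((b - a) / n.+1%:R).
Local Notation s := partition_point.

Section partition.
Context (a b : R) (ab : a < b) (n : nat).

Let step_gt0 : 0 < (b - a) / n.+1%:R.
Proof. by rewrite divr_gt0 ?subr_gt0 ?ltr0Sn. Qed.

Lemma partition_point0 : s a b n 0 = a.
Proof. by rewrite /s mul0r addr0. Qed.

Lemma partition_point_last : s a b n n.+1 = b.
Proof. by rewrite /s mulrCA mulfV ?pnatr_eq0 // mulr1 addrC subrK. Qed.

Lemma partition_pointS i : s a b n i.+1 = s a b n i + (b - a) / n.+1%:R.
Proof. by rewrite /s -natr1 mulrDl mul1r addrA. Qed.

Lemma le_partition_point i j : (i <= j)%N -> s a b n i <= s a b n j.
Proof. by move=> ij; rewrite lerD2l ler_pM2r // ler_nat. Qed.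

Lemma Rintegral_partition (g : R -> R) k : (k <= n.+1)%N ->
  mu.-integrable `]a, b] (EFin \o g) ->
  \int[mu]_(t in `]a, s a b n k]) g t =
  \sum_(i < k) \int[mu]_(t in `]s a b n i, s a b n i.+1]) g t.
Proof.
elim: k => [_ _|k IH kn ig].
  by rewrite partition_point0 big_ord0 set_itvoc0 Rintegral_set0.
rewrite big_ord_recr /= -IH //; last exact: ltnW.
have ak : a <= s a b n k by rewrite -{1}partition_point0 le_partition_point.
have kk : s a b n k <= s a b n k.+1 by rewrite le_partition_point.
have kb : s a b n k.+1 <= b by rewrite -[leRHS]partition_point_last le_partition_point.
have UE : `]a, s a b n k.+1]%classic =
    `]a, s a b n k]%classic `|` `]s a b n k, s a b n k.+1]%classic.
  by rewrite -itv_bndbnd_setU // bnd_simp.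
rewrite UE Rintegral_setU // -?UE.
  by apply: integrableS ig => //; apply: subset_itvl; rewrite bnd_simp.
apply/disj_setPS => t [] /=; rewrite !in_itv /= => /andP[_ tk] /andP[kt _].
by move: (lt_le_trans kt tk); rewrite ltxx.
Qed.

End partition.

(** Only [phi] is sampled; [f], merely integrable, enters through its exact masses. On a short
    interval [phi] is within [e / (W + 1)] of its value at the right end, so the total error is at
    most [e * W / (W + 1)]; the [+ 1] covers the case [W = 0]. *)
Lemma riemann_sum_cvg (f phi : R -> R) (a b : R) : a < b ->
  mu.-integrable `]a, b] (EFin \o f) -> (forall t, a < t <= b -> 0 <= f t) ->
  continuous phi ->
  \sum_(i < n.+1) (\int[mu]_(t in `]s a b n i, s a b n i.+1]) f t)
                  * phi (s a b n i.+1) @[n --> \oo] -->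
  \int[mu]_(t in `]a, b]) (f t * phi t).
Proof.
move=> ab fi f0 cphi.
have ifphi : mu.-integrable `]a, b] (EFin \o (fun t => f t * phi t)).
  have mphi : measurable_fun (`]a, b] : set R) phi.
    by apply: measurable_funTS; exact: continuous_measurable_fun.
  have bphi : [bounded phi t | t in (`]a, b] : set R)].
    have /compact_bounded[M [_ Mb]] : compact (phi @` `[a, b]).
      apply: continuous_compact (@segment_compact _ a b).
      exact: continuous_subspaceT.
    exists M; split; rewrite ?num_real // => y My t /= tab; apply: Mb => //.
    by exists t => //; apply: subset_itv_oc_cc.
  by have := @integrableMl _ _ _ mu _ _ _ _ fi mphi bphi; exact.
set W := \int[mu]_(t in `]a, b]) f t.
have W0 : 0 <= W by apply: Rintegral_ge0 => t /=; rewrite in_itv => /f0.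
apply/cvgrPdist_le => e e0.
have eW : 0 < e / (W + 1) by rewrite divr_gt0 // ltr_wpDl.
have [d d0 dP] := compact_uniform_continuity (@segment_compact _ a b) cphi eW.
have [N Nd] : exists N : nat, (b - a) / d < N%:R.
  exists (Num.bound ((b - a) / d)); apply: archi_boundP.
  by rewrite divr_ge0 ?ltW ?subr_gt0.
exists N => // n /= Nn.
have step : (b - a) / n.+1%:R < d.
  rewrite ltr_pdivrMr ?ltr0Sn // mulrC -ltr_pdivrMr // (lt_le_trans Nd) //.
  by rewrite ler_nat leqW.
have sub i : (i < n.+1)%N -> `]s a b n i, s a b n i.+1] `<=` `]a, b].
  move=> ni; apply: subset_itv; rewrite bnd_simp.
    by rewrite -{1}(@partition_point0 a b n) le_partition_point.
  by rewrite -[leRHS](@partition_point_last a b n) le_partition_point.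
have -> : \int[mu]_(t in `]a, b]) (f t * phi t) =
    \sum_(i < n.+1) \int[mu]_(t in `]s a b n i, s a b n i.+1]) (f t * phi t).
  by rewrite -Rintegral_partition // partition_point_last.
rewrite -sumrB; apply: le_trans (ler_norm_sum _ _ _) _.
have WE : W = \sum_(i < n.+1) \int[mu]_(t in `]s a b n i, s a b n i.+1]) f t.
  by rewrite -Rintegral_partition // partition_point_last.
apply: (@le_trans _ _ (e / (W + 1) * W)); last first.
  have W1 : 0 < W + 1 by rewrite ltr_wpDl.
  by rewrite mulrAC ler_pdivrMr // ler_wpM2l ?(ltW e0) // lerDl.
rewrite {2}WE mulr_sumr; apply: ler_sum => i _.
have mI : measurable (`]s a b n i, s a b n i.+1]%classic : set (measurableTypeR R)).
  exact: measurable_itv.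
have fiI : mu.-integrable `]s a b n i, s a b n i.+1] (EFin \o f).
  by apply: integrableS fi => //; exact: sub.
have iI : mu.-integrable `]s a b n i, s a b n i.+1] (EFin \o (fun t => f t * phi t)).
  by apply: integrableS ifphi => //; exact: sub.
have iI' : mu.-integrable `]s a b n i, s a b n i.+1]
    (EFin \o (fun t => f t * phi (s a b n i.+1))).
  by have := @integrableZr _ _ _ mu _ mI (phi (s a b n i.+1)) _ fiI; exact.
rewrite -RintegralZr // -RintegralB // -RintegralZl //.
have iB : mu.-integrable `]s a b n i, s a b n i.+1]
    (EFin \o (fun t => f t * phi t - f t * phi (s a b n i.+1))).
  by have := @integrableB _ _ _ mu _ mI _ _ iI iI'; exact.
apply: le_trans (le_normr_Rintegral mI iB) _; apply: le_Rintegral => //.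
- exact: (integrable_norm iB).
- by have := @integrableZl _ _ _ mu _ mI (e / (W + 1)) _ fiI; exact.
- move=> t /= tI; have := sub i (ltn_ord i) t tI; rewrite /= !in_itv /= => tab.
  have ft := f0 t tab.
  rewrite -mulrBr normrM (ger0_norm ft) mulrC ler_wpM2r // ltW //.
  move: tI; rewrite in_itv /= partition_pointS => /andP[t1 t2].
  rewrite distrC; apply: dP; first by case/andP: tab => [/ltW a_t tb]; rewrite /= in_itv /= a_t.
  by rewrite ger0_norm ?subr_ge0 // (le_lt_trans _ step) // lerBlDr addrC lerD2l ltW.
Qed.

(* The Riemann sums, normalized by the total mass of [f], are convex
   combinations of values of [p]; their cluster point is the integral. *)
Lemma pettis_integral (M : preTopologicalLmodType C) (E : set M) (p : R -> M)
    (a b : R) (f : R -> R) :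
  convex_set E -> compact_hull_property E -> continuous p ->
  (forall t, E (p t)) -> a < b -> mu.-integrable `]a, b] (EFin \o f) ->
  (forall t, a < t <= b -> 0 <= f t) ->
  exists2 q, E q & forall ev : M -> C^o, continuous ev -> linear ev ->
    (\int[mu]_(t in `]a, b]) f t)%:C * ev q =
    (\int[mu]_(t in `]a, b]) (f t * Re (ev (p t)))) +i*
    (\int[mu]_(t in `]a, b]) (f t * Im (ev (p t)))).
Proof.
move=> cvxE hullE cp Ep ab fi f0.
pose A := p @` `[a, b].
have cA : compact A.
  apply: continuous_compact (@segment_compact _ a b).
  exact: continuous_subspaceT.
have AE : A `<=` E by move=> _ [t _ <-].
set W := \int[mu]_(t in `]a, b]) f t.
have W0 : 0 <= W by apply: Rintegral_ge0 => t /=; rewrite in_itv => /f0.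
pose c n i := \int[mu]_(t in `]s a b n i, s a b n i.+1]) f t.
have sab n i : (i < n.+1)%N -> a <= s a b n i /\ s a b n i.+1 <= b.
  move=> ni; split; first by rewrite -{1}(@partition_point0 a b n) le_partition_point.
  by rewrite -[leRHS](@partition_point_last a b n) le_partition_point.
have c0 n i : (i < n.+1)%N -> 0 <= c n i.
  move=> /sab[s1 s2]; apply: Rintegral_ge0 => t /=; rewrite in_itv /= => /andP[t1 t2].
  by apply: f0; rewrite (le_lt_trans s1 t1) (le_trans t2 s2).
have WE n : W = \sum_(i < n.+1) c n i.
  by rewrite /c -Rintegral_partition // partition_point_last.
(* Without mass the sums cannot be normalized, but then all partial masses are 0, both sides of the
   identity vanish, and any point of [E] will do. *)
have [W_0|WN] := eqVneq W 0.
  exists (p a) => // ev cev lev.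
  have Z (phi : R -> R) : continuous phi ->
      \int[mu]_(t in `]a, b]) (f t * phi t) = 0.
    move=> cphi; have := riemann_sum_cvg ab fi f0 cphi.
    under eq_fun => n.
      rewrite big1; last first.
        move=> i _; have /eqP := esym (WE n); rewrite W_0 psumr_eq0; last by move=> j _; exact: c0.
        by move/allP => /(_ i (mem_index_enum i)) /eqP; rewrite /c => ->; rewrite mul0r.
      over.
    by move/(cvg_unique _ (cvg_cst _)) => <-.
  have cevp : continuous (ev \o p).
    by move=> t; exact: (continuous_comp (cp t) (cev (p t))).
  rewrite W_0 mul0r !Z //; move=> t; have /cvg_ReIm[] := cevp t; done.
pose h n : M := \sum_(i < n.+1) (c n i / W)%:C *: p (s a b n i.+1).
have Wgt : 0 < W by rewrite lt_neqAle eq_sym WN.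
have hH n H : A `<=` H -> convex_set H -> H (h n).
  move=> AH cvxH.
  apply: (@convex_combination _ _ H (fun i => c n i / W) (fun i => p (s a b n i.+1))) => //.
  - by move=> i /c0 ci; rewrite divr_ge0.
  - move=> i ni; apply: AH; exists (s a b n i.+1) => //=; rewrite in_itv /=.
    have [s1 ->] := sab n i ni; rewrite andbT (le_trans s1) //.
    exact: le_partition_point.
  - by rewrite -mulr_suml -WE mulfV.
have [q Eq hq] := hull_cluster cvxE hullE AE cA hH.
exists q => // ev cev lev.
pose z : C^o := (\int[mu]_(t in `]a, b]) (f t * Re (ev (p t))) / W) +i*
    (\int[mu]_(t in `]a, b]) (f t * Im (ev (p t))) / W).
have -> : ev q = z.
  apply: (cluster_eval cev hq); have cevp : continuous (ev \o p).
    by move=> t; exact: (continuous_comp (cp t) (cev (p t))).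
  pose levh : {linear M -> C^o} :=
    HB.pack ev (GRing.isLinear.Build C M C^o *:%R ev lev).
  have evh n : ev (h n) = \sum_(i < n.+1) (c n i / W)%:C * ev (p (s a b n i.+1)).
    rewrite -[ev]/(levh : M -> C^o) /h linear_sum; apply: eq_bigr => i _.
    by rewrite linearZ.
  apply/cvg_ReIm; split.
    have -> : (fun n => Re ((ev \o h) n)) =
      (fun n => (\sum_(i < n.+1) c n i * Re (ev (p (s a b n i.+1)))) * W^-1).
      apply/funext => n /=; rewrite evh raddf_sum mulr_suml; apply: eq_bigr => i _.
      rewrite [LHS]/= Re_mul /=.
      by rewrite mul0r subr0 mulrAC.
    rewrite /z /=; apply: cvgM (cvg_cst _).
    apply: (riemann_sum_cvg (phi := fun t => Re (ev (p t)))) => // t.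
    by have /cvg_ReIm[] := cevp t.
  have -> : (fun n => Im ((ev \o h) n)) =
    (fun n => (\sum_(i < n.+1) c n i * Im (ev (p (s a b n i.+1)))) * W^-1).
    apply/funext => n /=; rewrite evh raddf_sum mulr_suml; apply: eq_bigr => i _.
    rewrite [LHS]/= Im_mul /=.
    by rewrite mul0r addr0 mulrAC.
  rewrite /z /=; apply: cvgM (cvg_cst _).
  apply: (riemann_sum_cvg (phi := fun t => Im (ev (p t)))) => // t.
  by have /cvg_ReIm[] := cevp t.
by apply: complex_eqP; rewrite ?Re_mul ?Im_mul /z /=;
  rewrite mul0r ?subr0 ?addr0 mulrCA mulfV // mulr1.
Qed.

End riemann_sums.

(** * Bounds for continuous functionals and for operators on a subspace *)

Section continuous_functionals.
Context {R : realType} {X : normedModType R[i]}.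
Local Notation C := R[i].

Lemma linear_continuous_bounded (l : X -> C^o) : linear l -> continuous l ->
  exists2 M : R, 0 <= M & forall x, nrm (l x) <= M * nrm x.
Proof.
move=> ll cl; have lZ (a : C) x : l (a *: x) = a *: l x.
  have l0 : l 0 = 0 by have := ll (-1) 0 0; rewrite scaler0 addr0 scaleN1r addNr.
  by have := ll a x 0; rewrite !addr0 l0 addr0.
have /cvg_nrmP/(_ 1 ltr01)/nbhs_nrmP[d d0 ld] := cl 0.
have l0 : l 0 = 0 by rewrite -[X in l X](scale0r 0) lZ scale0r.
(* A vector rescaled to norm [d / 2] lies in the ball of radius [d] where [l] has norm below 1. *)
exists (2 / d) => [|x]; first by rewrite divr_ge0 ?ltW.
have [/nrm0_eq0 ->|x0] := eqVneq (nrm x) 0; first by rewrite l0 !nrm0 mulr0.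
have xgt : 0 < nrm x by rewrite lt_neqAle eq_sym x0 nrm_ge0.
pose c : R := d / 2 / nrm x.
have cgt : 0 < c by rewrite !divr_gt0.
have : nrm (l (c%:C *: x) - l 0) < 1.
  apply: ld; rewrite subr0 nrmZ nrm_real gtr0_norm // /c divfK //.
  by rewrite ltr_pdivrMr // ltr_pMr // ltr1n.
rewrite l0 subr0 lZ nrmZ nrm_real gtr0_norm // => /ltW cl1.
rewrite -(ler_pM2l cgt) (le_trans cl1) // /c.
by rewrite [leRHS](_ : _ = 1) //; field; rewrite x0 gt_eqF.
Qed.

Lemma functional_opnorm (l : X -> C^o) : linear l -> continuous l ->
  forall x, nrm (l x) <= opnorm setT l * nrm x.
Proof.
move=> ll cl x; have [M _ Mb] := linear_continuous_bounded ll cl.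
apply: (@opnorm_bound _ _ _ setT l M) => //.
move=> a y _; have l0 : l 0 = 0.
  by have := ll (-1) 0 0; rewrite scaler0 addr0 scaleN1r addNr.
by have := ll a y 0; rewrite !addr0 l0 addr0.
Qed.

End continuous_functionals.

Section linear_on.
Context {R : realType} {X : normedModType R[i]}.
Local Notation C := R[i].
Context (E : set X) (A : X -> X).

Hypotheses (E0 : E 0) (EZ : forall (a : C) x, E x -> E (a *: x)).
Hypothesis bA : bounded_operators E A.

Lemma bounded_operators0 : A 0 = 0.
Proof.
case: bA => _ lA _ _.
by have := lA (-1) 0 0 E0 E0; rewrite scaler0 addr0 scaleN1r addNr.
Qed.

Lemma bounded_operatorsZ (a : C) x : E x -> A (a *: x) = a *: A x.
Proof.
case: (bA) => _ lA _ _ Ex.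
by have := lA a x 0 Ex E0; rewrite bounded_operators0 !addr0.
Qed.

Lemma bounded_operatorsD x y : E x -> E y -> A (x + y) = A x + A y.
Proof. by case: bA => _ lA _ _ Ex Ey; have := lA 1 x y Ex Ey; rewrite !scale1r. Qed.

Lemma bounded_operatorsB x y : E x -> E y -> A (x - y) = A x - A y.
Proof.
move=> Ex Ey; rewrite bounded_operatorsD //; last by rewrite -scaleN1r; exact: EZ.
by rewrite -scaleN1r bounded_operatorsZ // scaleN1r.
Qed.

Lemma bounded_operators_opnorm x : E x -> nrm (A x) <= opnorm E A * nrm x.
Proof.
case: (bA) => _ _ [M Mb] _.
by apply: (@opnorm_bound _ _ _ E A M) => //; exact: bounded_operatorsZ.
Qed.

Lemma bounded_operators_opnorm_ge0 : 0 <= opnorm E A.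
Proof.
case: (bA) => _ _ [M Mb] _; apply: (@opnorm_ge0 _ _ _ E A `|M|) => // x /Mb.
by move/le_trans; apply; rewrite ler_wpM2r ?nrm_ge0 // ler_norm.
Qed.

End linear_on.

(** * Norms of a weakly continuous semigroup *)

Section weakly_continuous_semigroup.
Context {R : realType} {X : completeNormedModType R[i]}.
Local Notation C := R[i].
Context (Xs : set (functional X)) (T : R -> X -> X).
Hypotheses (hXs : dual_pairing Xs) (hT : weak_semigroup Xs T).

Lemma pairing_linear (l : X -> C^o) : Xs l -> linear l.
Proof. by case/(dual_pairing_sub hXs). Qed.

Lemma pairing_continuous (l : X -> C^o) : Xs l -> continuous l.
Proof. by case/(dual_pairing_sub hXs). Qed.

Section linearity.
Context (l : X -> C^o) (Xsl : Xs l).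

Let L : {linear X -> C^o} :=
  HB.pack l (GRing.isLinear.Build C X C^o *:%R l (pairing_linear Xsl)).

Lemma pairing0 : l 0 = 0. Proof. exact: (linear0 L). Qed.
Lemma pairingB x y : l (x - y) = l x - l y. Proof. exact: (linearB L). Qed.
Lemma pairingD x y : l (x + y) = l x + l y. Proof. exact: (linearD L). Qed.
Lemma pairingZ (a : C) x : l (a *: x) = a * l x. Proof. exact: (linearZ_LR L). Qed.

Lemma pairing_opnorm x : nrm (l x) <= opnorm setT l * nrm x.
Proof. exact: (functional_opnorm (pairing_linear Xsl) (pairing_continuous Xsl)). Qed.

Lemma pairing_opnorm_ge0 : 0 <= opnorm setT l.
Proof.
have [M M0 Mb] := linear_continuous_bounded (pairing_linear Xsl) (pairing_continuous Xsl).
exact: (@opnorm_ge0 _ _ _ setT l M).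
Qed.

End linearity.

Lemma nrm_le_pairing (x : X) (c : R) :
  (forall l : X -> C^o, Xs l -> opnorm setT l <= 1 -> nrm (l x) <= c) ->
  nrm x <= c.
Proof.
move=> lc; rewrite (dual_pairing_norm hXs); apply: ge_sup.
  exists (nrm ((0 : X -> C^o) x)), (0 : X -> C^o) => //; split.
    exact: dual_pairing0.
  apply: opnorm_le => // y _.
  by rewrite nrm0 mulr_ge0 // nrm_ge0.
by move=> _ [l [Xsl l1] <-]; exact: lc.
Qed.

Lemma pairing_sep (x y : X) : (forall l : X -> C^o, Xs l -> l x = l y) -> x = y.
Proof.
move=> lxy; apply/eqP; rewrite -subr_eq0; apply/eqP/nrm0_eq0/eqP.
rewrite eq_le nrm_ge0 andbT; apply: nrm_le_pairing => l Xsl _.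
by rewrite pairingB // lxy // subrr nrm0.
Qed.

Lemma cvg_weak (x : X) : nbhs (x : X) --> (x : weak Xs).
Proof.
have := @cvg_weakP _ _ Xs X (nbhs x) _ (fun y : X => y : weak Xs) x.
by case=> _; apply => l Xsl; exact: pairing_continuous.
Qed.

Lemma semigroup_bounded t : 0 < t -> bounded_operators setT (T t).
Proof. by case/(weak_semigroup_bounded hT). Qed.

Lemma semigroup_pairing t (l : X -> C^o) : 0 < t -> Xs l -> Xs (l \o T t).
Proof. by case/(weak_semigroup_bounded hT) => _; apply. Qed.

Lemma semigroupD s t x : 0 < s -> 0 < t -> T s (T t x) = T (s + t) x.
Proof. by move=> s0 t0; rewrite (weak_semigroupD hT). Qed.

Local Notation w t := (opnorm setT (T t)).

Lemma semigroup_opnorm t x : 0 < t -> nrm (T t x) <= w t * nrm x.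
Proof.
by move=> t0; exact: (bounded_operators_opnorm I (fun _ _ _ => I) (semigroup_bounded t0)).
Qed.

Lemma semigroup_opnorm_ge0 t : 0 < t -> 0 <= w t.
Proof. by move=> t0; exact: (bounded_operators_opnorm_ge0 I (semigroup_bounded t0)). Qed.

(** [w] is the supremum of the continuous functions [nrm (l (T t x))] over [x] and [l] of norm at
    most 1, the pairing being norming. *)
Lemma semigroup_opnorm_lsc t c : 0 < t -> c < w t ->
  \forall s \near t, 0 < s /\ c < w s.
Proof.
move=> t0 cw; have : has_sup [set nrm (T t x) | x in [set x | setT x /\ nrm x <= 1]].
  split; first by exists (nrm (T t 0)), 0 => //=; rewrite nrm0.
  exists (w t) => _ [x [_ x1] <-]; rewrite (le_trans (semigroup_opnorm x t0)) //.
  by rewrite ler_piMr // semigroup_opnorm_ge0.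
move=> hs; have := @sup_adherent _ _ (w t - c) _ hs; rewrite subr_gt0 => /(_ cw).
rewrite subKr => -[_ [x [_ x1] <-] cT].
have [l [Xsl l1 cl]] : exists l : X -> C^o,
    [/\ Xs l, opnorm setT l <= 1 & c < nrm (l (T t x))].
  apply: contrapT => nl; move: cT; apply/negP; rewrite -leNgt.
  apply: nrm_le_pairing => l Xsl l1; rewrite leNgt; apply/negP => cl.
  by apply: nl; exists l.
have lc := @weak_semigroup_continuous _ _ _ _ hT x _ Xsl.
have /lc/cvg_nrmP : t \in `]0, +oo[ by rewrite in_itv /= t0.
move=> /(_ (nrm (l (T t x)) - c)); rewrite subr_gt0 => /(_ cl) near_l.
have near0 : \forall s \near t, 0 < s by exact: lt_nbhsr.
apply: filterS2 near_l near0 => s ls s0; split=> //.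
have : c < nrm (l (T s x)).
  have := nrmD (l (T t x) - l (T s x)) (l (T s x)); rewrite subrK nrmB.
  by move: ls; lra.
move/lt_le_trans; apply; apply: (le_trans (pairing_opnorm Xsl _)).
apply: (@le_trans _ _ (nrm (T s x))); first by rewrite ler_piMl // nrm_ge0.
by rewrite (le_trans (semigroup_opnorm x s0)) // ler_piMr // semigroup_opnorm_ge0.
Qed.

Lemma semigroup_opnorm_measurable : measurable_fun (`]0, +oo[%classic : set R) (fun t => w t).
Proof.
(* The value [-oo] at nonpositive times keeps [f] lower semicontinuous on the whole line, since its
   strict superlevel sets are open subsets of the positive half-line. *)
pose f (t : R) : \bar R := if 0 < t then (w t)%:E else -oo%E.
have lf : lower_semicontinuous f.
  apply/lower_semicontinuousP => a; rewrite openE => t /=.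
  rewrite /f; case: ifPn => // t0; rewrite lte_fin => aw.
  by apply: filterS (semigroup_opnorm_lsc t0 aw) => s /= [-> ]; rewrite lte_fin.
have mf := lower_semicontinuous_measurable lf.
apply/measurable_EFinP; apply: (eq_measurable_fun f); last exact: measurable_funTS mf.
by move=> t; rewrite inE /= in_itv /= andbT /f => ->.
Qed.

(** If all the [U n] were dense, Baire's theorem would give a point of [K] where [w] exceeds every
    integer. Hence some [U n] misses a nonempty open set, which then lies in [K] and on which
    [w <= n]. The ends of [K] only serve to keep it inside []0, d[]. *)
Lemma semigroup_locally_bounded (d : R) : 0 < d ->
  exists a b M : R, [/\ 0 < a, a < b, b < d &
    forall t, a < t < b -> w t <= M].
Proof.
move=> d0; pose K := `[d / 3, d / 2]%classic.
pose U (n : nat) := ~` K `|` [set t : R | 0 < t /\ n%:R < w t].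
have oU n : open (U n).
  apply: openU; first by rewrite openC; exact: interval_closed.
  rewrite openE => t [/= t0 nt]; exact: semigroup_opnorm_lsc.
have [n nU] : exists n, ~ dense (U n).
  apply: contrapT => /forallNP dU.
  have odU n : open (U n) /\ dense (U n) by split; [exact: oU|exact: contrapT (dU n)].
  have [||t [tK Ut]] := @Baire R R U odU `]d / 3, d / 2[%classic.
  - by exists (d / 3 + d / 12); rewrite /= in_itv /=; apply/andP; split; lra.
  - exact: interval_open.
  have := Ut (Num.bound (w t)) I; case.
    by apply; move: tK; rewrite /K /= !in_itv /= => /andP[/ltW -> /ltW ->].
  move=> [t0]; apply/negP; rewrite -leNgt ltW // archi_boundP //.
  exact: semigroup_opnorm_ge0.
have [V [[t Vt] [oV VU]]] : exists V, V !=set0 /\ open V /\ ~ (V `&` U n !=set0).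
  by apply: contrapT => H; apply: nU => V V0 oV; apply: contrapT => VU; apply: H; exists V.
have VK s : V s -> d / 3 <= s <= d / 2 /\ w s <= n%:R.
  move=> Vs; have Ks : K s.
    by apply: contrapT => Ks; apply: VU; exists s; split=> //; left.
  have ds : d / 3 <= s <= d / 2 by move: Ks; rewrite /K /= in_itv.
  split=> //; rewrite leNgt; apply/negP => nw; apply: VU; exists s; split=> //; right.
  by split=> //; apply: lt_le_trans (andP ds).1; rewrite divr_gt0.
have : nbhs t V by exact: open_nbhs_nbhs.
rewrite -nbhs_ballE => -[e /= e0 eV].
have [/andP[t1 t2] _] := VK t Vt.
have VI s : t < s < t + e -> V s.
  move=> /andP[s1 s2]; apply: eV; rewrite /ball /= ltr_distlC.
  by apply/andP; split; lra.
have sV : V (t + e / 2) by apply: VI; apply/andP; split; lra.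
have [/andP[_ te] _] := VK _ sV.
exists t, (t + e / 2), n%:R; split; [lra|lra|lra|].
by move=> s /andP[s1 s2]; apply: (VK s _).2; apply: VI; apply/andP; split; lra.
Qed.

End weakly_continuous_semigroup.
(** * Complex-valued integrals *)

Section real_fubini.
Context {R : realType}.
Local Notation RT := (measurableTypeR R).
Local Notation mu := (@lebesgue_measure R).

(** Domination by a product bounds the iterated integral of [|h|] by the product of the integrals of
    [u] and [v]. It also makes every section integrable, and not only almost every one, so that
    [fine] can be removed from the inner integrals pointwise. *)
Lemma Rintegral_fubini (h : RT * RT -> R) (u v : R -> R) :
  measurable_fun setT h ->
  mu.-integrable setT (EFin \o u) -> mu.-integrable setT (EFin \o v) ->
  (forall t, 0 <= u t) -> (forall s, 0 <= v s) ->
  (forall t s, `|h (t, s)| <= u t * v s) ->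
  \int[mu]_t \int[mu]_s h (t, s) = \int[mu]_s \int[mu]_t h (t, s).
Proof.
move=> mh iu iv u0 v0 huv.
have mhE : measurable_fun setT (EFin \o h) by exact/measurable_EFinP.
have i1 t : mu.-integrable setT (fun s => (h (t, s))%:E).
  apply: (@le_integrable _ _ _ mu _ _ _ (fun s => (u t * v s)%:E)) => //.
  - by apply/measurable_EFinP; apply: measurableT_comp mh _; exact: measurable_pair1.
  - by move=> s _ /=; rewrite lee_fin [leRHS]ger0_norm ?mulr_ge0.
  - by have := @integrableZl _ _ _ mu setT measurableT (u t) _ iv; exact.
have i2 s : mu.-integrable setT (fun t => (h (t, s))%:E).
  apply: (@le_integrable _ _ _ mu _ _ _ (fun t => (u t * v s)%:E)) => //.
  - by apply/measurable_EFinP; apply: measurableT_comp mh _; exact: measurable_pair2.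
  - by move=> t _ /=; rewrite lee_fin [leRHS]ger0_norm ?mulr_ge0.
  - by have := @integrableZr _ _ _ mu setT measurableT (v s) _ iu; exact.
have ih : (mu \x mu)%E.-integrable setT (EFin \o h).
  apply/integrable12ltyP => //.
  apply: (@le_lt_trans _ _ (\int[mu]_t ((u t)%:E * \int[mu]_s (v s)%:E))%E).
    apply: ge0_le_integral => //.
    - by move=> t _; exact: integral_ge0.
    - apply: (measurable_fun_fubini_tonelli_F (abse \o (EFin \o h))) => //.
        exact: measurableT_comp.
      by move=> z; exact: abse_ge0.
    - apply: emeasurable_funM => //; first exact: measurable_int iu.
    - move=> t _; rewrite -ge0_integralZl //.
      + apply: ge0_le_integral => //.
        * by apply: measurableT_comp => //; exact: measurable_int (i1 t).
        * by apply/measurable_EFinP; apply: measurable_funM => //; apply/measurable_EFinP; exact: measurable_int iv.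
        * by move=> s _; rewrite lee_fin.
      + by exact: measurable_int iv.
      + by move=> s _; rewrite lee_fin.
      + by rewrite lee_fin.
  rewrite ge0_integralZr //.
  - apply: lte_mul_pinfty.
    + by apply: integral_ge0 => t _; rewrite lee_fin.
    + by apply: integrable_fin_num.
    + by rewrite ltey_eq (integrable_fin_num _ iv).
  - by exact: measurable_int iu.
  - by move=> t _; rewrite lee_fin.
  - by apply: integral_ge0 => t _; rewrite lee_fin.
have FE := @Fubini _ _ RT RT R mu mu (EFin \o h) ih.
rewrite /Rintegral; congr fine; transitivity (\int[mu]_t \int[mu]_s (h (t, s))%:E)%E.
  by apply: eq_integral => t _; rewrite fineK //; exact: integrable_fin_num (i1 t).
by rewrite FE; apply: eq_integral => s _; rewrite fineK //; exact: integrable_fin_num (i2 s).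
Qed.

End real_fubini.

Section complex_integral.
Context {R : realType}.
Local Notation C := R[i].
Local Notation RT := (measurableTypeR R).
Local Notation mu := (@lebesgue_measure R).

Definition cintegrable (D : set RT) (g : R -> C) : Prop :=
  mu.-integrable D (EFin \o (fun t => Re (g t))) /\
  mu.-integrable D (EFin \o (fun t => Im (g t))).

Lemma cmeasurable_funM (D : set RT) (f g : R -> C) :
  cmeasurable_fun D f -> cmeasurable_fun D g ->
  cmeasurable_fun D (fun t => f t * g t).
Proof.
move=> [fR fI] [gR gI]; split.
  under eq_fun do rewrite Re_mul.
  by apply: measurable_funB; exact: measurable_funM.
under eq_fun do rewrite Im_mul.
by apply: measurable_funD; exact: measurable_funM.
Qed.

Lemma eq_cintegral (D : set RT) (f g : R -> C) : (forall t, D t -> f t = g t) ->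
  cintegral D f = cintegral D g.
Proof.
move=> fg; rewrite /cintegral; congr (_ +i* _); apply: eq_Rintegral => t;
  by rewrite inE => /fg ->.
Qed.

Section domain.
Context (D : set RT) (mD : measurable D).

Lemma le_cintegrable (g : R -> C) (v : R -> R) : cmeasurable_fun D g ->
  mu.-integrable D (EFin \o v) -> (forall t, D t -> nrm (g t : C^o) <= v t) ->
  cintegrable D g.
Proof.
move=> [gR gI] iv gv; split.
  apply: (@le_integrable _ _ _ mu _ mD _ (EFin \o v)) => //.
    exact/measurable_EFinP.
  move=> t Dt /=; rewrite lee_fin (le_trans (normr_Re_le _)) //.
  by rewrite (le_trans (gv t Dt)) // ler_norm.
apply: (@le_integrable _ _ _ mu _ mD _ (EFin \o v)) => //.
  exact/measurable_EFinP.
move=> t Dt /=; rewrite lee_fin (le_trans (normr_Im_le _)) //.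
by rewrite (le_trans (gv t Dt)) // ler_norm.
Qed.

Lemma cintegralD (f g : R -> C) : cintegrable D f -> cintegrable D g ->
  cintegral D (fun t => f t + g t) = cintegral D f + cintegral D g.
Proof.
move=> [fR fI] [gR gI]; rewrite /cintegral.
under eq_Rintegral do rewrite raddfD /=.
under [X in _ +i* X]eq_Rintegral do rewrite raddfD /=.
by rewrite !RintegralD.
Qed.

Lemma cintegralZ (c : C) (f : R -> C) : cintegrable D f ->
  cintegral D (fun t => c * f t) = c * cintegral D f.
Proof.
move=> [fR fI]; have iZ (r : R) (h : R -> R) : mu.-integrable D (EFin \o h) ->
    mu.-integrable D (EFin \o (fun t => r * h t)).
  by move=> ih; have := @integrableZl _ _ _ mu D mD r _ ih; exact.
apply: complex_eqP; rewrite ?Re_mul ?Im_mul /=.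
  under eq_Rintegral do rewrite Re_mul.
  by rewrite RintegralB ?RintegralZl //; exact: iZ.
under eq_Rintegral do rewrite Im_mul.
by rewrite RintegralD ?RintegralZl //; exact: iZ.
Qed.

(* The factor 2 comes from bounding the real and imaginary parts separately. *)
Lemma nrm_cintegral_le (f : R -> C) (v : R -> R) : cmeasurable_fun D f ->
  mu.-integrable D (EFin \o v) -> (forall t, D t -> nrm (f t : C^o) <= v t) ->
  nrm (cintegral D f : C^o) <= 2 * \int[mu]_(t in D) v t.
Proof.
move=> mf iv fv; have [fR fI] := le_cintegrable mf iv fv.
rewrite (le_trans (nrm_le_ReIm _)) // mulr2n mulrDl mul1r lerD //=.
  rewrite (le_trans (le_normr_Rintegral mD fR)) //; apply: le_Rintegral => //.
    exact: integrable_norm fR.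
  by move=> t Dt; rewrite (le_trans (normr_Re_le _)) ?fv.
rewrite (le_trans (le_normr_Rintegral mD fI)) //; apply: le_Rintegral => //.
  exact: integrable_norm fI.
by move=> t Dt; rewrite (le_trans (normr_Im_le _)) ?fv.
Qed.

End domain.
End complex_integral.

(** * Fubini's theorem for complex-valued integrals *)

Section complex_fubini.
Context {R : realType}.
Local Notation C := R[i].
Local Notation RT := (measurableTypeR R).
Local Notation mu := (@lebesgue_measure R).

Lemma cmeasurable_restrict (D : set RT) (f : R -> C) : measurable D ->
  cmeasurable_fun D f -> cmeasurable_fun setT (fun t => if t \in D then f t else 0).
Proof.
move=> mD [fR fI]; split.
  have -> : (fun t => Re (if t \in D then f t else 0)) = (fun t => Re (f t)) \_ D.
    by apply/funext => t; rewrite patchE; case: ifP.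
  exact/(measurable_restrictT _ mD).
have -> : (fun t => Im (if t \in D then f t else 0)) = (fun t => Im (f t)) \_ D.
  by apply/funext => t; rewrite patchE; case: ifP.
exact/(measurable_restrictT _ mD).
Qed.

Lemma Rintegral_fubini_on (D : set RT) (h : RT -> RT -> R) (u v : R -> R) :
  measurable D ->
  measurable_fun setT (fun z : RT * RT => (h z.1 z.2)) ->
  (forall t s, ~ D t \/ ~ D s -> h t s = 0) ->
  mu.-integrable D (EFin \o u) -> mu.-integrable D (EFin \o v) ->
  (forall t, D t -> 0 <= u t) -> (forall s, D s -> 0 <= v s) ->
  (forall t s, D t -> D s -> `|h t s| <= u t * v s) ->
  \int[mu]_(t in D) \int[mu]_(s in D) h t s =
  \int[mu]_(s in D) \int[mu]_(t in D) h t s.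
Proof.
move=> mD mh h0 iu iv u0 v0 huv.
have hD : forall t, \int[mu]_(s in D) h t s = \int[mu]_s h t s.
  move=> t; rewrite Rintegral_mkcond; apply: eq_Rintegral => s _.
  by rewrite patchE; case: ifPn => // /negP; rewrite inE => Ds; rewrite h0 //; right.
have hD' : forall s, \int[mu]_(t in D) h t s = \int[mu]_t h t s.
  move=> s; rewrite Rintegral_mkcond; apply: eq_Rintegral => t _.
  by rewrite patchE; case: ifPn => // /negP; rewrite inE => Dt; rewrite h0 //; left.
have iT (r : R -> R) : mu.-integrable D (EFin \o r) ->
    mu.-integrable setT (EFin \o (r \_ D)).
  by move=> ir; rewrite -restrict_EFin; exact: (integrable_mkcond _ mD).1 ir.
have := @Rintegral_fubini R (fun z => h z.1 z.2) (u \_ D) (v \_ D) mh (iT _ iu) (iT _ iv).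
have r0 (r : R -> R) : (forall t, D t -> 0 <= r t) -> forall t, 0 <= (r \_ D) t.
  by move=> r0 t; rewrite patchE; case: ifPn => //; rewrite inE => /r0.
move=> /(_ (r0 _ u0) (r0 _ v0)) /= FE.
rewrite Rintegral_mkcond [RHS]Rintegral_mkcond.
transitivity (\int[mu]_t \int[mu]_s h t s).
  apply: eq_Rintegral => t _; rewrite patchE; case: ifPn => [_|/negP]; first exact: hD.
  rewrite inE => Dt; rewrite (_ : (fun s => h t s) = cst 0) ?Rintegral_cst ?mul0r //.
  by apply/funext => s; rewrite h0 //; left.
rewrite FE; last first.
  move=> t s; rewrite !patchE; case: ifPn; rewrite (inE, notin_setE) => Dt; last first.
    by rewrite h0 ?normr0 ?mul0r //; left.
  case: ifPn; rewrite (inE, notin_setE) => Ds; first exact: huv.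
  by rewrite h0 ?normr0 ?mulr0 //; right.
apply: eq_Rintegral => s _; rewrite patchE; case: ifPn => [_|/negP]; first by rewrite hD'.
rewrite inE => Ds; rewrite (_ : (fun t => h t s) = cst 0) ?Rintegral_cst ?mul0r //.
by apply/funext => t; rewrite h0 //; right.
Qed.

Lemma cintegral_convolution_fubini (D : set RT) (f g k : R -> C) (u v : R -> R) :
  measurable D -> (forall t s, D t -> D s -> D (t + s)) ->
  cmeasurable_fun D f -> cmeasurable_fun D g -> cmeasurable_fun D k ->
  mu.-integrable D (EFin \o u) -> mu.-integrable D (EFin \o v) ->
  (forall t, D t -> 0 <= u t) -> (forall s, D s -> 0 <= v s) ->
  (forall t s, D t -> D s -> nrm (f t * g s * k (t + s) : C^o) <= u t * v s) ->
  cintegral D (fun t => cintegral D (fun s => f t * g s * k (t + s))) =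
  cintegral D (fun s => cintegral D (fun t => f t * g s * k (t + s))).
Proof.
move=> mD DD mf mg mk iu iv u0 v0 fgk.
(* The three functions are measurable on [D] only, hence the cut-offs, which make [H] measurable on
   the plane. As [D] is stable under addition, the cut-off of [k (t + s)] changes nothing on [D]
   times [D]. *)
pose H t s := (if t \in D then f t else 0) * (if s \in D then g s else 0) *
  (if t + s \in D then k (t + s) else 0).
have HE t s : D t -> D s -> f t * g s * k (t + s) = H t s.
  by move=> Dt Ds; rewrite /H !mem_set //; exact: DD.
have H0 t s : ~ D t \/ ~ D s -> H t s = 0.
  by case=> nD; rewrite /H (memNset nD) ?mul0r ?mulr0 ?mul0r.
have mfst (f' : R -> R) : measurable_fun setT f' ->
    measurable_fun setT (fun z : RT * RT => f' z.1).
  by move=> mf'; apply: measurableT_comp mf' _; exact: measurable_fst.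
have msnd (f' : R -> R) : measurable_fun setT f' ->
    measurable_fun setT (fun z : RT * RT => f' z.2).
  by move=> mf'; apply: measurableT_comp mf' _; exact: measurable_snd.
have madd (f' : R -> R) : measurable_fun setT f' ->
    measurable_fun setT (fun z : RT * RT => f' (z.1 + z.2)).
  move=> mf'; apply: measurableT_comp mf' _.
  by apply: measurable_funD; [exact: measurable_fst|exact: measurable_snd].
have [fR fI] := cmeasurable_restrict mD mf.
have [gR gI] := cmeasurable_restrict mD mg.
have [kR kI] := cmeasurable_restrict mD mk.
move: (mfst _ fR) (mfst _ fI) (msnd _ gR) (msnd _ gI) (madd _ kR) (madd _ kI).
move=> {}fR {}fI {}gR {}gI {}kR {}kI.
have mHR : measurable_fun setT (fun z : RT * RT => Re (H z.1 z.2)).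
  rewrite /H; under eq_fun do rewrite !Re_mul Im_mul.
  apply: measurable_funB; apply: measurable_funM; try assumption.
    by apply: measurable_funB; apply: measurable_funM; assumption.
  by apply: measurable_funD; apply: measurable_funM; assumption.
have mHI : measurable_fun setT (fun z : RT * RT => Im (H z.1 z.2)).
  rewrite /H; under eq_fun do rewrite !Im_mul Re_mul.
  apply: measurable_funD; apply: measurable_funM; try assumption.
    by apply: measurable_funB; apply: measurable_funM; assumption.
  by apply: measurable_funD; apply: measurable_funM; assumption.
clearbody H.
transitivity (cintegral D (fun t => cintegral D (fun s => H t s))).
  by apply: eq_cintegral => t Dt; apply: eq_cintegral => s Ds; exact: HE.
transitivity (cintegral D (fun s => cintegral D (fun t => H t s))); last first.
  by apply: eq_cintegral => s Ds; apply: eq_cintegral => t Dt; rewrite HE.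
have HRE : \int[mu]_(t in D) \int[mu]_(s in D) Re (H t s) =
    \int[mu]_(s in D) \int[mu]_(t in D) Re (H t s).
  apply: (Rintegral_fubini_on mD mHR _ iu iv u0 v0) => [t s ts|t s Dt Ds].
    by rewrite H0.
  by rewrite (le_trans (normr_Re_le _)) // -HE // fgk.
have HIE : \int[mu]_(t in D) \int[mu]_(s in D) Im (H t s) =
    \int[mu]_(s in D) \int[mu]_(t in D) Im (H t s).
  apply: (Rintegral_fubini_on mD mHI _ iu iv u0 v0) => [t s ts|t s Dt Ds].
    by rewrite H0.
  by rewrite (le_trans (normr_Im_le _)) // -HE // fgk.
by rewrite /cintegral; cbn [complex.Re complex.Im]; rewrite HRE HIE.
Qed.

End complex_fubini.
(** * The map phi *)

Section phi.
Context {R : realType} {X : completeNormedModType R[i]}.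
Local Notation C := R[i].
Local Notation RT := (measurableTypeR R).
Local Notation mu := (@lebesgue_measure R).
Context (Xs : set (functional X)) (T : R -> X -> X).
Hypotheses (hXs : dual_pairing Xs) (hT : weak_semigroup Xs T).
Local Notation w t := (opnorm setT (T t)).
Local Notation D := (`]0, +oo[%classic : set RT).

Let mD : measurable D. Proof. exact: measurable_itv. Qed.

Lemma orbit_cmeasurable (l : X -> C^o) x : Xs l ->
  cmeasurable_fun D (fun t => l (T t x)).
Proof.
move=> Xsl; have cl := @weak_semigroup_continuous _ _ _ _ hT x _ Xsl.
split; apply: open_continuous_measurable_fun; try exact: interval_open.
  by move=> t /set_mem tD; have /cvg_ReIm[] := cl t tD.
by move=> t /set_mem tD; have /cvg_ReIm[] := cl t tD.
Qed.

Lemma orbit_bound (l : X -> C^o) t x : Xs l -> 0 < t ->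
  nrm (l (T t x)) <= opnorm setT l * nrm x * w t.
Proof.
move=> Xsl t0; rewrite (le_trans (pairing_opnorm hXs Xsl _)) // -mulrA.
rewrite ler_wpM2l ?(pairing_opnorm_ge0 hXs) // mulrC.
exact: semigroup_opnorm hT _ _ t0.
Qed.

Lemma measurable_nrm (f : R -> C) : cmeasurable_fun D f ->
  measurable_fun D (fun t => nrm (f t : C^o)).
Proof.
move=> [fR fI].
have -> : (fun t => nrm (f t : C^o)) =
    (fun t => Num.sqrt (Re (f t) ^+ 2 + Im (f t) ^+ 2)).
  by apply/funext => t; apply: complexI; rewrite -nrmE; exact: normc_def.
have ms : measurable_fun setT (@Num.sqrt R).
  by apply: continuous_measurable_fun; exact: sqrt_continuous.
apply: measurableT_comp ms _; apply: measurable_funD; exact: measurable_funX.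
Qed.

Section integrable_weight.
Context (f : R -> C) (Lf : L1omega T f).

Lemma L1omega_cmeasurable : cmeasurable_fun D f. Proof. by case: Lf. Qed.

Lemma L1omega_integrable (c : R) :
  mu.-integrable D (EFin \o (fun t => c * (nrm (f t : C^o) * w t))).
Proof.
have i1 : mu.-integrable D (EFin \o (fun t => nrm (f t : C^o) * w t)).
  apply/integrableP; split.
    apply/measurable_EFinP; apply: measurable_funM.
      exact: measurable_nrm L1omega_cmeasurable.
    exact: semigroup_opnorm_measurable hXs hT.
  case: Lf => _; apply: le_lt_trans; rewrite le_eqVlt; apply/orP; left; apply/eqP.
  apply: eq_integral => t; rewrite inE /= in_itv /= andbT => t0.
  by rewrite ger0_norm // mulr_ge0 ?nrm_ge0 // (semigroup_opnorm_ge0 hT t0).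
by have := @integrableZl _ _ _ mu D mD c _ i1; exact.
Qed.

Lemma phi_cintegrable (l : X -> C^o) x : Xs l ->
  cintegrable D (fun t => f t * l (T t x)).
Proof.
move=> Xsl; apply: (le_cintegrable mD _ (L1omega_integrable (opnorm setT l * nrm x))).
  exact: cmeasurable_funM L1omega_cmeasurable (orbit_cmeasurable x Xsl).
move=> t /=; rewrite in_itv /= andbT => t0.
by rewrite nrmM mulrCA ler_wpM2l ?nrm_ge0 // orbit_bound.
Qed.

End integrable_weight.

(** Since [l \o T s] belongs to [Xs], the formula for [A] applies to it; the two integrands then
    agree because the semigroup is commutative. *)
Lemma phi_semigroup f A s x : is_phi Xs T f A -> 0 < s ->
  A (T s x) = T s (A x).
Proof.
move=> [_ fA] s0; apply: (pairing_sep hXs) => l Xsl.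
have := fA x _ (semigroup_pairing hT s0 Xsl); rewrite /= => ->; rewrite (fA _ _ Xsl).
apply: eq_cintegral => t /=; rewrite in_itv /= andbT => t0.
by rewrite !(semigroupD hT) // addrC.
Qed.

(** Both products are the double integral of [f t * g s * l (T (t + s) x)], in the two orders of
    integration. The product majorant comes from bounding the norm of [T t (T s x)] by
    [w t * w s * nrm x]. *)
Lemma phi_comm f g A B x : L1omega T f -> L1omega T g ->
  is_phi Xs T f A -> is_phi Xs T g B -> A (B x) = B (A x).
Proof.
move=> Lf Lg [_ fA] [_ gB]; apply: (pairing_sep hXs) => l Xsl.
pose k t := l (T t x).
have AB f' g' A' B' : L1omega T f' -> L1omega T g' ->
    (forall x l, Xs l -> l (A' x) = cintegral `]0, +oo[ (fun t => f' t * l (T t x))) ->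
    (forall x l, Xs l -> l (B' x) = cintegral `]0, +oo[ (fun t => g' t * l (T t x))) ->
    l (A' (B' x)) =
    cintegral D (fun t => cintegral D (fun s => f' t * g' s * k (t + s))).
  move=> Lf' Lg' fA' gB'; rewrite fA' //; apply: eq_cintegral => t /= tD.
  move: (tD); rewrite in_itv /= andbT => t0.
  have XslT := semigroup_pairing hT t0 Xsl.
  have := gB' x _ XslT; rewrite /= => ->; rewrite -cintegralZ //; last exact: (phi_cintegrable Lg' x XslT).
  apply: eq_cintegral => s /=; rewrite in_itv /= andbT => s0.
  by rewrite (semigroupD hT) // mulrA.
apply: (etrans (AB f g A B Lf Lg fA gB)).
apply: (etrans _ (esym (AB g f B A Lg Lf gB fA))).
pose u t := (opnorm setT l * nrm x) * (nrm (f t : C^o) * w t).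
(* The factor 1 only gives [v] the shape covered by [L1omega_integrable]. *)
pose v s := 1 * (nrm (g s : C^o) * w s).
have iu : mu.-integrable D (EFin \o u) := L1omega_integrable Lf _.
have iv : mu.-integrable D (EFin \o v) := L1omega_integrable Lg _.
have mk : cmeasurable_fun D k := orbit_cmeasurable x Xsl.
have Dpos t : D t -> 0 < t by rewrite /= in_itv /= andbT.
have DD t s : D t -> D s -> D (t + s).
  by move=> /Dpos t0 /Dpos s0; rewrite /= in_itv /= andbT addr_gt0.
have u0 t : D t -> 0 <= u t.
  move=> /Dpos t0.
  by rewrite /u !mulr_ge0 ?nrm_ge0 ?(pairing_opnorm_ge0 hXs Xsl) // (semigroup_opnorm_ge0 hT t0).
have v0 t : D t -> 0 <= v t.
  by move=> /Dpos t0; rewrite /v !mulr_ge0 ?nrm_ge0 // (semigroup_opnorm_ge0 hT t0).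
have fgk t s : D t -> D s -> nrm (f t * g s * k (t + s) : C^o) <= u t * v s.
  move=> /Dpos t0 /Dpos s0; rewrite !nrmM.
  have kts : nrm (k (t + s) : C^o) <= opnorm setT l * nrm x * (w t * w s).
    rewrite /k -(semigroupD hT) //; apply: (le_trans (orbit_bound _ Xsl t0)).
    rewrite -!mulrA ler_wpM2l ?(pairing_opnorm_ge0 hXs Xsl) //.
    rewrite mulrC [leRHS]mulrCA ler_wpM2l ?(semigroup_opnorm_ge0 hT t0) // mulrC.
    exact: (semigroup_opnorm hT x s0).
  apply: (@le_trans _ _ (nrm (f t : C^o) * nrm (g s : C^o) *
    (opnorm setT l * nrm x * (w t * w s)))).
    by rewrite ler_wpM2l // mulr_ge0 ?nrm_ge0.
  by rewrite le_eqVlt /u /v; apply/orP; left; apply/eqP; ring.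
have FE := cintegral_convolution_fubini mD DD (L1omega_cmeasurable Lf)
  (L1omega_cmeasurable Lg) mk iu iv u0 v0 fgk.
apply: (etrans FE); apply: eq_cintegral => s _; apply: eq_cintegral => t _.
by rewrite (mulrC (g s)) (addrC s).
Qed.

End phi.
(** * Averages of orbits *)

Section averages.
Context {R : realType} {X : completeNormedModType R[i]}.
Local Notation C := R[i].
Local Notation RT := (measurableTypeR R).
Local Notation mu := (@lebesgue_measure R).
Context (Xs : set (functional X)) (T : R -> X -> X).
Hypotheses (hXs : dual_pairing Xs) (hT : weak_semigroup Xs T).
Local Notation w t := (opnorm setT (T t)).
Local Notation D := (`]0, +oo[%classic : set RT).
Local Notation I a b := (`]a, b]%classic : set RT).

Let mI a b : measurable (I a b). Proof. exact: measurable_itv. Qed.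

Lemma cintegrableZ (E : set RT) (c : C) (g : R -> C) : measurable E ->
  cintegrable E g -> cintegrable E (fun t => c * g t).
Proof.
move=> mE [gR gI]; split.
  rewrite (_ : _ \o _ = EFin \o (fun t => Re c * Re (g t) - Im c * Im (g t))).
    have := @integrableB _ _ _ mu _ mE _ _
      (@integrableZl _ _ _ mu _ mE (Re c) _ gR)
      (@integrableZl _ _ _ mu _ mE (Im c) _ gI); exact.
  by apply/funext => t; rewrite /comp Re_mul.
rewrite (_ : _ \o _ = EFin \o (fun t => Re c * Im (g t) + Im c * Re (g t))).
  have := @integrableD _ _ _ mu _ mE _ _
    (@integrableZl _ _ _ mu _ mE (Re c) _ gI)
    (@integrableZl _ _ _ mu _ mE (Im c) _ gR); exact.
by apply/funext => t; rewrite /comp Im_mul.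
Qed.

Lemma integrable_cst_itv (a b c : R) : mu.-integrable (I a b) (EFin \o (fun=> c)).
Proof.
apply: measurable_bounded_integrable => //.
  have := @lebesgue_measure_itv R `]a, b]; rewrite /= => ->.
  by case: ifP => // _; rewrite -EFinB ltry.
by exists `|c|; split; rewrite ?num_real // => M cM t _; exact: ltW.
Qed.

Lemma Rintegral_cst_itv (a b c : R) : a <= b ->
  \int[mu]_(t in I a b) c = c * (b - a).
Proof.
move=> ab; rewrite Rintegral_cst //; congr (_ * _).
have := @lebesgue_measure_itv R `]a, b]; rewrite /= => ->; rewrite lte_fin; case: ltP => // ba.
by rewrite (@le_anti _ _ a b) ?ab ?ba // subrr.
Qed.

(** The orbit is continuous at positive times only. Freezing the time at [a] on the left gives a
    function continuous on the whole line that agrees with the orbit on []a, b]]. *)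
Lemma orbit_continuous (x : X) (a s : R) : s < a ->
  continuous (fun t => T (Num.max a t - s) x : weak Xs).
Proof.
move=> sa t; apply/cvg_weakP => l Xsl.
have cl := @weak_semigroup_continuous _ _ _ _ hT x _ Xsl.
have tD : Num.max a t - s \in `]0, +oo[ by rewrite in_itv /= andbT subr_gt0 lt_max sa.
have cm : {for t, continuous (fun r : R => Num.max a r - s)}.
  apply: cvgB; last exact: cvg_cst.
  by apply: (@continuous_max _ _ (fun=> a) id t); [exact: cvg_cst|exact: cvg_id].
exact: (continuous_comp cm (cl _ tD)).
Qed.

(** The delay [s] is 0 for the averages themselves; a delay [a / 2] leaves room to pull [T (a / 2)]
    out of the integral. *)
Lemma orbit_integral (x : X) (a b s : R) : s < a -> a < b ->
  exists q : X, forall l : X -> C^o, Xs l ->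
    l q = cintegral (I a b) (fun t => l (T (t - s) x)).
Proof.
move=> sa ab.
have [|||||||q _ lq] := @pettis_integral R (weak Xs) setT
  (fun t => T (Num.max a t - s) x : weak Xs) a b (fun=> 1).
- by [].
- exact: dual_pairing_hull.
- exact: orbit_continuous.
- by [].
- exact: ab.
- exact: integrable_cst_itv.
- by move=> t _; exact: ler01.
(* For the weight 1 the point [q] is the mean of the orbit over []a, b]]; the factor [b - a] turns
   it into the integral. *)
exists ((b - a)%:C *: (q : X)) => l Xsl; rewrite (pairingZ hXs) //.
have := lq l (weak_eval_continuous Xsl) (pairing_linear hXs Xsl).
rewrite Rintegral_cst_itv ?ltW // mul1r => ->.
rewrite /cintegral; congr (_ +i* _); apply: eq_Rintegral => t;
  rewrite inE /= in_itv /= => /andP[/ltW at_ _]; by rewrite mul1r max_r.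
Qed.

Definition indicator (a b : R) (t : R) : C := (\1_(I a b) t)%:C.

Lemma cintegral_indicator (a b : R) (h : R -> C) : 0 < a ->
  cintegral D (fun t => indicator a b t * h t) = cintegral (I a b) h.
Proof.
move=> a0; have IE : I a b = D `&` I a b.
  apply/seteqP; split=> [t tI|t []//]; split=> //.
  by move: tI; rewrite /= !in_itv /= andbT => /andP[/(lt_trans a0)].
rewrite /cintegral IE !Rintegral_mkcondr.
congr (_ +i* _); apply: eq_Rintegral => t _; rewrite patchE /indicator indicE;
  case: ifP => _; by rewrite ?Re_mul ?Im_mul /= !mul0r ?mul1r ?subr0 ?addr0.
Qed.

Lemma L1omega_indicator (a b M : R) : 0 < a -> a < b ->
  (forall t, a < t <= b -> w t <= M) -> L1omega T (indicator a b).
Proof.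
move=> a0 ab wM; split.
  split; last by exact: measurable_cst.
  by apply: measurable_funTS; exact: measurable_indic.
apply: (@le_lt_trans _ _ (\int[mu]_(t in D) (M * \1_(I a b) t)%:E)%E).
  apply: ge0_le_integral => //.
  - move=> t; rewrite /= in_itv /= andbT => t0.
    by rewrite lee_fin mulr_ge0 ?nrm_ge0 // (semigroup_opnorm_ge0 hT t0).
  - apply/measurable_EFinP; apply: measurable_funM; last exact: semigroup_opnorm_measurable hXs hT.
    apply: measurable_nrm; split; last by exact: measurable_cst.
    by apply: measurable_funTS; exact: measurable_indic.
  - by apply/measurable_EFinP; exact: measurable_funM.
  - move=> t; rewrite /= in_itv /= andbT => t0; rewrite lee_fin nrm_real indicE.
    case: (boolP (t \in _)) => [|_]; last by rewrite normr0 mul0r mulr0.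
    by rewrite inE /= in_itv /= => /wM; rewrite normr1 mul1r mulr1.
have M1 : mu.-integrable D (EFin \o (fun t => M * \1_(I a b) t)).
  have i1 : mu.-integrable D (EFin \o \1_(I a b)).
    apply: (@integrableS _ _ _ mu setT) => //.
    by apply: integrable_indic_itv.
  by have := @integrableZl _ _ _ mu D (measurable_itv _) M _ i1; exact.
have := @integrable_fin_num _ _ _ mu D (measurable_itv _) _ M1.
by rewrite fin_numE ltey => /andP[].
Qed.

Lemma orbit_cintegrable (l : X -> C^o) x (a b M : R) : Xs l -> 0 < a ->
  (forall t, a < t <= b -> w t <= M) ->
  cintegrable (I a b) (fun t => l (T t x)).
Proof.
move=> Xsl a0 wM.
apply: (@le_cintegrable _ _ (mI a b) _ (fun=> opnorm setT l * nrm x * M)).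
- have DI : I a b `<=` D.
    by move=> t; rewrite /= !in_itv /= andbT => /andP[/(lt_trans a0)].
  have [kR kI] := orbit_cmeasurable hT x Xsl.
  by split; [exact: measurable_funS kR|exact: measurable_funS kI].
- exact: integrable_cst_itv.
move=> t /=; rewrite in_itv /= => tab; have /andP[at_ _] := tab.
apply: (le_trans (orbit_bound hXs hT x Xsl (lt_trans a0 at_))).
by rewrite ler_wpM2l ?wM // mulr_ge0 ?nrm_ge0 ?(pairing_opnorm_ge0 hXs Xsl).
Qed.

(** The values of [A] are chosen one by one. Linearity follows because [Xs] separates points, and
    boundedness because it is norming. *)
Lemma average_operator (a b M : R) : 0 < a -> a < b ->
  (forall t, a < t <= b -> w t <= M) ->
  exists A, is_phi Xs T (indicator a b) A /\ forall x, range (T (a / 2)) (A x).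
Proof.
move=> a0 ab wM.
pose A x := sval (cid (orbit_integral x a0 ab)).
have lA (l : X -> C^o) x : Xs l -> l (A x) = cintegral (I a b) (fun t => l (T t x)).
  move=> Xsl; rewrite /A; case: cid => q /= ->//.
  by apply: eq_cintegral => t _; rewrite subr0.
have a2 : 0 < a / 2 by rewrite divr_gt0.
have a2a : a / 2 < a by lra.
have Tlin t (c : C) x y : 0 < t -> T t (c *: x + y) = c *: T t x + T t y.
  by move=> /(semigroup_bounded hT)[_ lT _ _]; exact: lT.
exists A; split; last first.
  (* The orbit delayed by [a / 2] is still taken at positive times, and [T (a / 2)] applied to its
     integral [q] restores the undelayed one. *)
  move=> x; have [q lq] := orbit_integral x a2a ab.
  exists q => //; apply: (pairing_sep hXs) => l Xsl; rewrite lA //.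
  have := lq _ (semigroup_pairing hT a2 Xsl); rewrite /= => ->.
  apply: eq_cintegral => t /=; rewrite in_itv /= => /andP[at_ _].
  by rewrite (semigroupD hT) ?subr_gt0 ?(lt_trans a2a) // addrC subrK.
split; last by move=> x l Xsl; rewrite lA // -cintegral_indicator.
split=> [//|c x y _ _||x nx]; last by case: nx.
  apply: (pairing_sep hXs) => l Xsl; rewrite (pairingD hXs) // (pairingZ hXs) //.
  have ix := orbit_cintegrable x Xsl a0 wM; have iy := orbit_cintegrable y Xsl a0 wM.
  rewrite !lA // -cintegralZ // -cintegralD //; last first.
    exact: cintegrableZ ix.
  apply: eq_cintegral => t /=; rewrite in_itv /= => /andP[at_ _].
  have t0 := lt_trans a0 at_.
  by rewrite Tlin // (pairingD hXs) // (pairingZ hXs).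
exists (2 * (M * (b - a))) => x _; apply: (nrm_le_pairing hXs) => l Xsl l1.
rewrite lA //.
apply: (@le_trans _ _ (2 * \int[mu]_(t in I a b) (nrm x * M))); last first.
  by rewrite (Rintegral_cst_itv _ (ltW ab)) le_eqVlt; apply/orP; left; apply/eqP; ring.
apply: nrm_cintegral_le => //.
- have DI : I a b `<=` D.
    by move=> t; rewrite /= !in_itv /= andbT => /andP[/(lt_trans a0)].
  have [kR kI] := orbit_cmeasurable hT x Xsl.
  by split; [exact: measurable_funS kR|exact: measurable_funS kI].
- exact: integrable_cst_itv.
move=> t /=; rewrite in_itv /= => tab; have /andP[at_ _] := tab.
apply: (le_trans (orbit_bound hXs hT x Xsl (lt_trans a0 at_))).
apply: (@le_trans _ _ (nrm x * w t)); last by rewrite ler_wpM2l ?nrm_ge0 ?wM.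
rewrite -mulrA ler_piMl // mulr_ge0 ?nrm_ge0 //.
exact: (semigroup_opnorm_ge0 hT (lt_trans a0 at_)).
Qed.

Lemma cintegral_cst (a b : R) (z : C) : a <= b ->
  cintegral (I a b) (fun=> z) = (b - a)%:C * z.
Proof.
move=> ab; apply: complex_eqP; rewrite ?Re_mul ?Im_mul /= Rintegral_cst_itv //.
  by rewrite mul0r subr0 mulrC.
by rewrite mul0r addr0 mulrC.
Qed.

(** This is right continuity of the orbit at [c], integrated. It is uniform in [b'] because it
    serves both for one fixed average and for the limit as [b'] tends to [c]. *)
Lemma orbit_average_cvg (l : X -> C^o) (x : X) (c d M e : R) : Xs l ->
  0 < c -> c < d -> (forall t, c < t < d -> w t <= M) -> 0 < e ->
  exists2 b, c < b < d &
    forall b', c < b' <= b ->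
    nrm (cintegral (I c b') (fun t => l (T t x)) - (b' - c)%:C * l (T c x) : C^o)
      <= e * (b' - c).
Proof.
move=> Xsl c0 cd wM e0; have cl := @weak_semigroup_continuous _ _ _ _ hT x _ Xsl.
have cD : c \in `]0, +oo[ by rewrite in_itv /= c0.
(* Half of [e], since [nrm_cintegral_le] loses a factor 2. *)
have e2 : 0 < e / 2 by rewrite divr_gt0.
have /cvg_nrmP/(_ _ e2) := cl c cD.
rewrite -nbhs_ballE => -[r /= r0 kr].
(* The first bound stays within the radius of continuity at [c], the second below [d], where
   [w <= M]. *)
pose b := Num.min (c + r / 2) ((c + d) / 2).
have [br bd] : b <= c + r / 2 /\ b <= (c + d) / 2 by rewrite !ge_min !lexx orbT.
have cb : c < b by rewrite lt_min; apply/andP; split; lra.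
exists b; first by rewrite cb; lra.
move=> b' /andP[cb' b'b].
have wM' t : c < t <= b' -> w t <= M by move=> /andP[t1 t2]; apply: wM; lra.
have ik := orbit_cintegrable x Xsl c0 wM'.
have iz : cintegrable (I c b') (fun=> - l (T c x)).
  by split; exact: integrable_cst_itv.
have -> : cintegral (I c b') (fun t => l (T t x)) - (b' - c)%:C * l (T c x) =
    cintegral (I c b') (fun t => l (T t x) - l (T c x)).
  by rewrite (cintegralD (mI _ _) ik iz) (cintegral_cst _ (ltW cb')) mulrN.
apply: (@le_trans _ _ (2 * \int[mu]_(t in I c b') (e / 2))); last first.
  by rewrite (Rintegral_cst_itv _ (ltW cb')) le_eqVlt; apply/orP; left; apply/eqP; field.
apply: nrm_cintegral_le => //.
- have DI : I c b' `<=` D.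
    by move=> t; rewrite /= !in_itv /= andbT => /andP[/(lt_trans c0)].
  have [kR kI] := orbit_cmeasurable hT x Xsl; split.
    apply: (eq_measurable_fun (fun t => Re (l (T t x)) - Re (l (T c x)))).
      by move=> t _; rewrite raddfB.
    by apply: measurable_funB => //; exact: measurable_funS kR.
  apply: (eq_measurable_fun (fun t => Im (l (T t x)) - Im (l (T c x)))).
    by move=> t _; rewrite raddfB.
  by apply: measurable_funB => //; exact: measurable_funS kI.
- exact: integrable_cst_itv.
move=> t /=; rewrite in_itv /= => /andP[t1 t2]; apply: ltW; apply: kr.
by rewrite /ball /= ltr_distlC; apply/andP; split; lra.
Qed.

End averages.
(** * The Arveson ideal *)

Section small_norm.
Context {R : realType} {V : normedModType R[i]}.

Lemma le0_of_small (a c : R) : (forall e : R, 0 < e -> a <= e * c) -> a <= 0.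
Proof.
move=> h; rewrite leNgt; apply/negP => a0.
have c1 : 0 < `|c| + 1 by rewrite ltr_wpDl.
have := h _ (divr_gt0 (divr_gt0 a0 (ltr0Sn _ 1)) c1).
have : a / 2 / (`|c| + 1) * c <= a / 2.
  rewrite mulrAC ler_pdivrMr // ler_wpM2l //; first by rewrite divr_ge0 // ltW.
  by rewrite ltW // (le_lt_trans (ler_norm c)) // ltrDl.
move=> h1 h2; have := le_trans h2 h1; lra.
Qed.

(** Used to pass identities to norm limits: [c] collects the norms that do not depend on the
    precision [e] of the approximation. *)
Lemma nrm_small_eq (x y : V) (c : R) :
  (forall e : R, 0 < e -> nrm (x - y) <= e * c) -> x = y.
Proof.
move=> /le0_of_small n0; apply/eqP; rewrite -subr_eq0; apply/eqP/nrm0_eq0/eqP.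
by rewrite eq_le n0 nrm_ge0.
Qed.

End small_norm.

Section arveson.
Context {R : realType} {X : completeNormedModType R[i]}.
Local Notation C := R[i].
Context (Xs : set (functional X)) (T : R -> X -> X).
Hypotheses (hXs : dual_pairing Xs) (hT : weak_semigroup Xs T).
Local Notation w t := (opnorm setT (T t)).
Local Notation X1 := (X1 T).

Lemma X1P x : X1 x <->
  forall e : R, 0 < e -> exists t z, 0 < t /\ nrm (T t z - x) < e.
Proof.
split=> [/closure_nrmP h e /h[_ [t /= tD [z _ <-]] te]|h].
  by exists t, z; split=> //; move: tD; rewrite in_itv /= andbT.
apply/closure_nrmP => e /h[t [z [t0 te]]]; exists (T t z) => //.
by exists t; [rewrite /= in_itv /= t0|exists z].
Qed.

Lemma X1_semigroup t x : 0 < t -> X1 (T t x).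
Proof. by move=> t0; apply/X1P => e e0; exists t, x; rewrite subrr nrm0. Qed.

Lemma X1_closed x : (forall e : R, 0 < e -> exists2 y, X1 y & nrm (y - x) < e) -> X1 x.
Proof.
move=> h; apply/X1P => e e0; have e2 : 0 < e / 2 by rewrite divr_gt0.
have [y /X1P/(_ _ e2)[t [z [t0 ty]]] yx] := h _ e2.
exists t, z; split=> //; apply: (le_lt_trans (nrm_triangle _ y _)).
by rewrite [e]splitr ltrD.
Qed.

Lemma semigroup_lin t (c : C) x y : 0 < t -> T t (c *: x + y) = c *: T t x + T t y.
Proof. by move=> /(semigroup_bounded hT)[_ lT _ _]; exact: lT. Qed.

Lemma semigroup_linB t x y : 0 < t -> T t (x - y) = T t x - T t y.
Proof. by move=> t0; rewrite addrC -scaleN1r semigroup_lin // scaleN1r addrC. Qed.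

(** The range of [T t] grows as [t] decreases, so vectors from two ranges lie in a common one; the
    union of the ranges is thus a subspace. *)
Lemma X1_lin (c : C) x y :
  X1 x -> X1 y -> X1 (c *: x + y).
Proof.
move=> /X1P hx /X1P hy; apply/X1P => e e0.
have n0 : 0 < nrm (c : C^o) + 1 by rewrite ltr_wpDl ?nrm_ge0.
have e2 : 0 < e / 2 by rewrite divr_gt0.
have [t [z [t0 tx]]] := hx _ (divr_gt0 e2 n0).
have [s [z' [s0 sy]]] := hy _ e2.
(* Halving puts [r] strictly below both times, so that [t - r] and [s - r] are positive. *)
pose r := Num.min t s / 2.
have r0 : 0 < r by rewrite divr_gt0 // lt_min t0.
have rt : r < t by rewrite /r (@le_lt_trans _ _ (t / 2)) ?ler_pM2r ?ge_min ?lexx //; lra.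
have rs : r < s by rewrite /r (@le_lt_trans _ _ (s / 2)) ?ler_pM2r ?ge_min ?lexx ?orbT //; lra.
exists r, (c *: T (t - r) z + T (s - r) z'); split=> //.
rewrite semigroup_lin // !(semigroupD hT) ?subr_gt0 // !(addrC r) !subrK.
rewrite opprD addrACA -scalerBr (le_lt_trans (nrmD _ _)) // [e]splitr ltrD //.
rewrite nrmZ (@le_lt_trans _ _ ((nrm (c : C^o) + 1) * nrm (T t z - x))) //.
  by rewrite ler_wpM2r ?nrm_ge0 // lerDl.
by rewrite -ltr_pdivlMl // mulrC.
Qed.

Lemma X1_0 : X1 0.
Proof.
apply/X1P => e e0; exists 1, 0; split=> //.
by rewrite (bounded_operators0 I (semigroup_bounded hT ltr01)) subrr nrm0.
Qed.

Lemma X1Z (c : C) x : X1 x -> X1 (c *: x).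
Proof. by move=> Xx; have := @X1_lin c x 0 Xx X1_0; rewrite addr0. Qed.

Lemma X1B x y : X1 x -> X1 y -> X1 (x - y).
Proof. by move=> Xx Xy; rewrite addrC -scaleN1r; exact: X1_lin. Qed.

(* [A] commutes with the semigroup, hence preserves the closure of its ranges. *)
Lemma phi_X1 f A x : is_phi Xs T f A -> X1 x -> X1 (A x).
Proof.
move=> fA; have bA := fA.1 => /X1P hx; apply: X1_closed => e e0.
have n0 : 0 < opnorm setT A + 1.
  by rewrite ltr_wpDl // (bounded_operators_opnorm_ge0 I bA).
have [t [z [t0 tz]]] := hx _ (divr_gt0 e0 n0).
exists (A (T t z)); first by rewrite (phi_semigroup hXs hT _ fA t0); exact: X1_semigroup.
have AB := bounded_operatorsB I (fun _ _ _ => I) bA.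
rewrite -AB // (le_lt_trans (bounded_operators_opnorm I (fun _ _ _ => I) bA I)) //.
rewrite (@le_lt_trans _ _ ((opnorm setT A + 1) * nrm (T t z - x))) //.
  by rewrite ler_wpM2r ?nrm_ge0 // lerDl.
by rewrite -ltr_pdivlMl // mulrC.
Qed.

Lemma opnorm_sub_lt (A B : X -> X) (e : R) :
  bounded_operators X1 A -> bounded_operators X1 B ->
  opnorm X1 (A \- B) < e -> forall x, X1 x -> nrm (A x - B x) <= e * nrm x.
Proof.
move=> bA bB ABe x Xx.
have [_ _ [MA hA] _] := bA; have [_ _ [MB hB] _] := bB.
apply: (@le_trans _ _ (opnorm X1 (A \- B) * nrm x)); last first.
  by rewrite ler_wpM2r ?nrm_ge0 // ltW.
apply: (@opnorm_bound _ _ _ X1 (A \- B) (MA + MB)) => //.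
- exact: X1Z.
- move=> c y Xy /=.
  rewrite (bounded_operatorsZ X1_0 bA) // (bounded_operatorsZ X1_0 bB) //.
  by rewrite scalerBr.
move=> y Xy /=; rewrite (le_trans (nrmD _ _)) // nrmN mulrDl lerD //; [exact: hA|exact: hB].
Qed.

Lemma patch_X1 (A : X -> X) x : X1 x -> patch (fun=> 0) X1 A x = A x.
Proof. by move=> Xx; rewrite /patch mem_set. Qed.

Lemma phi_patch_bounded f A : is_phi Xs T f A ->
  bounded_operators X1 (patch (fun=> 0) X1 A).
Proof.
move=> fA; have [_ lA [M bA] _] := fA.1; split.
- by move=> x Xx; rewrite patch_X1 //; exact: phi_X1 fA Xx.
- by move=> c x y Xx Xy; rewrite !patch_X1 ?lA //; exact: X1_lin.
- by exists M => x Xx; rewrite patch_X1 //; exact: bA.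
- by move=> x nX; rewrite /patch memNset.
Qed.

Lemma phi_arveson f A : L1omega T f -> is_phi Xs T f A ->
  Arveson_ideal Xs T (patch (fun=> 0) X1 A).
Proof.
move=> Lf fA; split; first exact: phi_patch_bounded fA.
move=> e e0; exists (patch (fun=> 0) X1 A).
  by exists A => //; exists f.
apply: le_lt_trans e0; apply: opnorm_le => //; first exact: X1_0.
by move=> x _ /=; rewrite subrr nrm0 mul0r.
Qed.

Lemma arveson_bounded u : Arveson_ideal Xs T u -> bounded_operators X1 u.
Proof. by case. Qed.

Lemma arveson_X1 u x : Arveson_ideal Xs T u -> X1 x -> X1 (u x).
Proof. by move=> /arveson_bounded[uX _ _ _]; exact: uX. Qed.

Lemma arveson_approx u (e : R) : Arveson_ideal Xs T u -> 0 < e ->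
  exists f A, [/\ L1omega T f, is_phi Xs T f A &
    forall x, X1 x -> nrm (u x - A x) <= e * nrm x].
Proof.
move=> [bu hu] /hu[_ [A [f Lf fA] <-] uA]; exists f, A; split=> // x Xx.
have := opnorm_sub_lt bu (phi_patch_bounded fA) uA Xx.
by rewrite patch_X1.
Qed.

Lemma arveson_opnorm u x : Arveson_ideal Xs T u -> X1 x ->
  nrm (u x) <= opnorm X1 u * nrm x.
Proof.
move=> /arveson_bounded bu.
by apply: bounded_operators_opnorm => //; [exact: X1_0|exact: X1Z].
Qed.

Lemma arveson_opnorm_ge0 u : Arveson_ideal Xs T u -> 0 <= opnorm X1 u.
Proof. by move=> /arveson_bounded; apply: bounded_operators_opnorm_ge0; exact: X1_0. Qed.

Lemma arveson_semigroup u s x : Arveson_ideal Xs T u -> 0 < s -> X1 x ->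
  u (T s x) = T s (u x).
Proof.
move=> hu s0 Xx; apply: (@nrm_small_eq _ _ _ _ (nrm (T s x) + w s * nrm x)) => e e0.
have [f [A [Lf fA uA]]] := arveson_approx hu e0.
apply: (le_trans (nrm_triangle _ (A (T s x)) _)); rewrite mulrDr lerD //.
  by apply: uA; exact: X1_semigroup.
rewrite (phi_semigroup hXs hT _ fA s0) -semigroup_linB //.
rewrite (le_trans (semigroup_opnorm hT _ s0)) // mulrCA.
by rewrite ler_wpM2l ?(semigroup_opnorm_ge0 hT s0) // nrmB uA.
Qed.

(** The limit is taken in one factor at a time: here in [u], against a fixed operator [A];
    [arveson_comm] then approximates one of two general elements by such an [A]. *)
Lemma arveson_phi u f A x : Arveson_ideal Xs T u -> L1omega T f ->
  is_phi Xs T f A -> X1 x -> u (A x) = A (u x).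
Proof.
move=> hu Lf fA Xx.
apply: (@nrm_small_eq _ _ _ _ (nrm (A x) + opnorm setT A * nrm x)) => e e0.
have [g [B [Lg gB uB]]] := arveson_approx hu e0.
apply: (le_trans (nrm_triangle _ (B (A x)) _)); rewrite mulrDr lerD //.
  by apply: uB; exact: phi_X1 fA Xx.
rewrite (phi_comm hXs hT x Lg Lf gB fA).
rewrite -(bounded_operatorsB I (fun _ _ _ => I) fA.1) //.
rewrite (le_trans (bounded_operators_opnorm I (fun _ _ _ => I) fA.1 I)) // mulrCA.
by rewrite ler_wpM2l ?(bounded_operators_opnorm_ge0 I fA.1) // nrmB uB.
Qed.

Lemma arveson_comm u v x : Arveson_ideal Xs T u -> Arveson_ideal Xs T v -> X1 x ->
  u (v x) = v (u x).
Proof.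
move=> hu hv Xx.
apply: (@nrm_small_eq _ _ _ _ (nrm (v x) + opnorm X1 v * nrm x)) => e e0.
have [f [A [Lf fA uA]]] := arveson_approx hu e0.
apply: (le_trans (nrm_triangle _ (A (v x)) _)); rewrite mulrDr lerD //.
  by apply: uA; exact: arveson_X1 hv Xx.
rewrite -(arveson_phi hv Lf fA Xx).
have XA := phi_X1 fA Xx; have Xu := arveson_X1 hu Xx.
rewrite -(bounded_operatorsB X1_0 X1Z (arveson_bounded hv)) //.
rewrite (le_trans (arveson_opnorm hv (X1B XA Xu))) // mulrCA.
by rewrite ler_wpM2l ?(arveson_opnorm_ge0 hv) // nrmB uA.
Qed.

Lemma omega_approx v a (e : R) : Omega Xs T v -> Arveson_ideal Xs T a -> 0 < e ->
  exists2 b, Arveson_ideal Xs T b &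
    forall x, X1 x -> nrm (a x - v (b x)) <= e * nrm x.
Proof.
move=> [hv vI] /[dup] ha /vI[_ /(_ _)] /[apply] -[_ [b hb <-] ab].
exists b => // x Xx; have := @opnorm_sub_lt a (v \o b) e (arveson_bounded ha) _ ab _ Xx; apply.
have [bX bl [Mb hMb] b0] := arveson_bounded hb.
have [vX vl [Mv hMv] v0] := arveson_bounded hv.
split.
- by move=> y Xy; apply: vX; exact: bX.
- by move=> c y z Xy Xz /=; rewrite bl // vl //; exact: bX.
- exists (opnorm X1 v * Mb) => y Xy /=.
  rewrite (le_trans (arveson_opnorm hv (bX _ Xy))) // -mulrA ler_wpM2l ?hMb //.
  exact: arveson_opnorm_ge0 hv.
- by move=> y nX /=; rewrite b0 // (bounded_operators0 X1_0 (arveson_bounded hv)).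
Qed.

End arveson.
(** * Injectivity and weak density *)

Section injectivity_density.
Context {R : realType} {X : completeNormedModType R[i]}.
Local Notation C := R[i].
Local Notation RT := (measurableTypeR R).
Context (Xs : set (functional X)) (T : R -> X -> X).
Hypotheses (hXs : dual_pairing Xs) (hT : weak_semigroup Xs T).
Local Notation w t := (opnorm setT (T t)).
Local Notation X1 := (X1 T).
Local Notation Xtilde := (Xtilde Xs T).
Local Notation I a b := (`]a, b]%classic : set RT).

(** Weak continuity at the positive time [a] is continuity at 0 of the orbit of [T a z]. *)
Lemma Xtilde_semigroup a z : 0 < a -> Xtilde (T a z).
Proof.
move=> a0; split=> [|l Xsl]; first exact: X1_semigroup.
have cl := @weak_semigroup_continuous _ _ _ _ hT z _ Xsl.
have aD : a \in `]0, +oo[ by rewrite in_itv /= a0.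
have /cvg_nrmP la := cl a aD; apply/cvg_nrmP => e /la; rewrite -nbhs_ballE.
move=> [r /= r0 ra]; have tr : \forall t \near 0^'+, t < r by exact: nbhs_right_lt.
have t0 : \forall t \near (0 : R)^'+, 0 < t by exact: nbhs_right_gt.
apply: filterS2 t0 tr => t t0 tr.
rewrite subr0 (semigroupD hT) // (pairingB hXs) //; apply: ra.
by rewrite /ball /= ltr_distlC; apply/andP; split; lra.
Qed.

(** By the semigroup law, vanishing at arbitrarily small times spreads to all positive times. Then
    [T t y - y] is the constant [- y], whose weak limit at 0 is also 0. *)
Lemma orbit_null y : (forall d, 0 < d -> exists2 c, 0 < c < d & T c y = 0) ->
  Xtilde y -> y = 0.
Proof.
move=> Tc0 [_ ly]; have Ty t : 0 < t -> T t y = 0.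
  move=> t0; have [c /andP[c0 ct] Tcy] := Tc0 t t0.
  have tc : 0 < t - c by rewrite subr_gt0.
  rewrite -(subrK c t) -(semigroupD hT) // Tcy.
  exact: (bounded_operators0 Logic.I (semigroup_bounded hT tc)).
apply: (pairing_sep hXs) => l Xsl; rewrite (pairing0 hXs Xsl).
have lim0 : (fun t : R => l (T t y - y)) @ 0^'+ --> - l y.
  apply/cvg_nrmP => e e0; have t0 : \forall t \near (0 : R)^'+, 0 < t by exact: nbhs_right_gt.
  apply: filterS t0 => t t0.
  by rewrite Ty // (pairingB hXs) // (pairing0 hXs) // sub0r subrr nrm0.
by apply: oppr_inj; rewrite oppr0; apply: (cvg_unique _ lim0 (ly l Xsl)).
Qed.

Lemma omega_injective v y : Omega Xs T v -> Xtilde y -> v y = 0 -> y = 0.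
Proof.
move=> hv ty vy0; have hv1 := hv.1; have [Xy _] := ty.
have I0 a : Arveson_ideal Xs T a -> a y = 0.
  move=> ha; apply: (@nrm_small_eq _ _ _ _ (nrm y)) => e e0.
  have [b hb ab] := omega_approx hT hv ha e0.
  have := ab y Xy; rewrite (arveson_comm hXs hT hv1 hb Xy) vy0.
  by rewrite (bounded_operators0 (X1_0 hT) (arveson_bounded hb)).
apply: orbit_null ty => d d0.
have [a [b [M [a0 ab bd wM]]]] := semigroup_locally_bounded hXs hT d0.
pose c := (a + b) / 2; have ac : a < c by rewrite /c; lra.
have cb : c < b by rewrite /c; lra.
have c0 : 0 < c by lra.
exists c; first by apply/andP; split; lra.
have wM' t : c < t < b -> w t <= M by move=> /andP[? ?]; apply: wM; lra.
apply: (pairing_sep hXs) => l Xsl; rewrite (pairing0 hXs Xsl).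
apply: (@nrm_small_eq _ (C^o) _ _ 1) => e e0; rewrite subr0 mulr1.
have [b1 /andP[cb1 b1b] h1] := orbit_average_cvg hXs hT y Xsl c0 cb wM' e0.
have wM1 t : c < t <= b1 -> w t <= M by move=> /andP[? ?]; apply: wM; lra.
have [A [hA _]] := average_operator hXs hT c0 cb1 wM1.
have /I0 := phi_arveson hXs hT (L1omega_indicator hXs hT c0 cb1 wM1) hA.
rewrite patch_X1 // => Ay0.
(* The average vanishes, so this estimate reads [(b1 - c) * nrm (l (T c y)) <= e * (b1 - c)]. *)
have := h1 b1; rewrite cb1 lexx => /(_ isT).
rewrite -cintegral_indicator // -(hA.2 y l Xsl) Ay0 (pairing0 hXs Xsl) sub0r nrmN.
have b0 : 0 < b1 - c by rewrite subr_gt0.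
by rewrite nrmM nrm_real (gtr0_norm b0) mulrC ler_pM2r.
Qed.

Section weak_density.
Context (u v : X -> X).
Hypotheses (hu : Arveson_ideal Xs T u) (hv : Omega Xs T v).
Local Notation K := (closure (dom_tilde Xs T u v : set (weak Xs))).

(** By commutation [u (v (T a z)) = v (T a (u z))], and [T a] maps into [Xtilde]. *)
Lemma dom_tilde_semigroup a z : 0 < a -> X1 z -> dom_tilde Xs T u v (v (T a z)).
Proof.
move=> a0 Xz; have hv1 := hv.1.
have XT : X1 (T a z) by exact: X1_semigroup.
split; first exact: arveson_X1 hv1 XT.
exists (T a (u z)); first exact: Xtilde_semigroup.
by rewrite (arveson_comm hXs hT hu hv1 XT) (arveson_semigroup hXs hT hu a0 Xz).
Qed.

(** Weak neighbourhoods are norm neighbourhoods, and [K], being a weak closure, is weakly closed. *)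
Lemma weak_closure_nrm (x : X) :
  (forall e : R, 0 < e -> exists2 y : X, K y & nrm (y - x) < e) -> K x.
Proof.
move=> h; apply: (@closed_closure (weak Xs)) => B /(cvg_weak hXs)/nbhs_nrmP[e e0 eB].
by have [y Ky /eB By] := h e e0; exists y.
Qed.

Lemma weak_closure_semigroup t x : 0 < t -> K (T t x).
Proof.
move=> t0; have hv1 := hv.1.
have [a [b [M [a0 ab bt wM]]]] := semigroup_locally_bounded hXs hT t0.
pose c := (a + b) / 2; have ac : a < c by rewrite /c; lra.
have cb : c < b by rewrite /c; lra.
have c0 : 0 < c by lra.
have wM' s : c < s < b -> w s <= M by move=> /andP[? ?]; apply: wM; lra.
(* This splits [T t x] as [T c (T r (T r x))]. The inner [T r] puts [z] in [X1], where the ideal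
   acts; the outer one is moved past an element [g] of the ideal and yields a vector [v (T r _)] of
   the domain. *)
pose r := (t - c) / 2; have r0 : 0 < r by rewrite /r; lra.
pose z := T r x; have Xz : X1 z by exact: X1_semigroup.
pose y := T r z; have Xy : X1 y by exact: X1_semigroup.
have yt : T c y = T t x.
  by rewrite /y /z !(semigroupD hT) ?addr_gt0 //; congr (T _ x); rewrite /r; field.
(* A choice function needs a value for every [d]; 0 is a default for [d <= c]. *)
have /choice[q hq] : forall d : R, exists q : X, c < d ->
    forall l : X -> C^o, Xs l -> l q = cintegral (I c d) (fun s => l (T s y)).
  move=> d; have [cd|dc] := boolP (c < d); last by exists 0.
  have [q hq] := orbit_integral hXs hT y c0 cd.
  by exists q => _ l /hq ->; apply: eq_cintegral => s _; rewrite subr0.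
pose f d : weak Xs := ((d - c)^-1)%:C *: q d.
have fK d : c < d < b -> K (f d).
  move=> /andP[cd db]; apply: weak_closure_nrm => e e0.
  have wM1 s : c < s <= d -> w s <= M by move=> /andP[? ?]; apply: wM; lra.
  have [A [hA _]] := average_operator hXs hT c0 cd wM1.
  have qA : q d = A y.
    apply: (pairing_sep hXs) => l Xsl.
    by rewrite hq // (hA.2 y l Xsl) cintegral_indicator.
  have dc0 : 0 < d - c by rewrite subr_gt0.
  have n1 : 0 < nrm y + 1 by rewrite ltr_wpDl ?nrm_ge0.
  (* The factor [d - c] compensates the normalization of the average, and [nrm y + 1] the error
     relative to [y], which may be 0. *)
  have e1 : 0 < e * (d - c) / (nrm y + 1) by rewrite divr_gt0 ?mulr_gt0.
  have ha := phi_arveson hXs hT (L1omega_indicator hXs hT c0 cd wM1) hA.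
  have [g hg ag] := omega_approx hT hv ha e1.
  exists (v (T r (((d - c)^-1)%:C *: g z))).
    apply: subset_closure; apply: dom_tilde_semigroup => //.
    by apply: (X1Z hT); exact: arveson_X1 hg Xz.
  have XTg : X1 (T r (g z)) by exact: X1_semigroup.
  have -> : T r (((d - c)^-1)%:C *: g z) = ((d - c)^-1)%:C *: T r (g z).
    by rewrite (bounded_operatorsZ Logic.I (semigroup_bounded hT r0)).
  rewrite (bounded_operatorsZ (X1_0 hT) (arveson_bounded hv1)) // /f -scalerBr.
  rewrite nrmZ nrm_real gtr0_norm ?invr_gt0 // mulrC ltr_pdivrMr //.
  rewrite qA nrmB -(arveson_semigroup hXs hT hg r0 Xz).
  have := ag y Xy; rewrite patch_X1 // => /le_lt_trans; apply.
  by rewrite -[ltRHS](divfK (lt0r_neq0 n1)) ltr_pM2l // ltrDl.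
have fc : f @ c^'+ --> (T t x : weak Xs).
  apply/cvg_weakP => l Xsl; rewrite -yt; apply/cvg_nrmP => e e0.
  have e2 : 0 < e / 2 by rewrite divr_gt0.
  have [b1 /andP[cb1 b1b] h1] := orbit_average_cvg hXs hT y Xsl c0 cb wM' e2.
  have dgt : \forall d \near c^'+, c < d by exact: nbhs_right_gt.
  have dlt : \forall d \near c^'+, d < b1 by exact: nbhs_right_lt.
  apply: filterS2 dgt dlt => d cd db1.
  have dc0 : 0 < d - c by rewrite subr_gt0.
  have := h1 d; rewrite cd ltW // => /(_ isT); rewrite -hq // => le1.
  have -> : l (f d) - l (T c y) = ((d - c)^-1)%:C * (l (q d) - (d - c)%:C * l (T c y)).
    rewrite /f (pairingZ hXs Xsl) mulrBr mulrA -rmorphM /= mulVf ?gt_eqF // mul1r //.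
  rewrite nrmM nrm_real gtr0_norm ?invr_gt0 // mulrC ltr_pdivrMr //.
  by rewrite (le_lt_trans le1) // ltr_pM2r //; lra.
have cK : closed (K : set (weak Xs)) by exact: closed_closure.
have nK : \forall d \near c^'+, K (f d).
  have dgt : \forall d \near c^'+, c < d by exact: nbhs_right_gt.
  have dlt : \forall d \near c^'+, d < b by exact: nbhs_right_lt.
  by apply: filterS2 dgt dlt => d cd db; apply: fK; rewrite cd.
apply: cK => B /fc Bf; have [d [Kd Bd]] := filter_ex (filterI nK Bf).
by exists (f d).
Qed.

Lemma dom_tilde_dense : X1 `<=` K.
Proof.
move=> x /X1P h; apply: weak_closure_nrm => e /h[t [z [t0 tz]]].
by exists (T t z) => //; exact: weak_closure_semigroup.
Qed.

End weak_density.

End injectivity_density.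
(** * Semigroups bounded near 0 *)

Section bounded_semigroup.
Context {R : realType} {X : completeNormedModType R[i]}.
Local Notation C := R[i].
Context (Xs : set (functional X)) (T : R -> X -> X).
Hypotheses (hXs : dual_pairing Xs) (hT : weak_semigroup Xs T).
Local Notation w t := (opnorm setT (T t)).
Local Notation X1 := (X1 T).
Local Notation Xtilde := (Xtilde Xs T).

Hypothesis limsup_w : (limf_esup (fun t => (w t)%:E) 0^'+ < +oo)%E.

Lemma limsup_bounded : exists d M : R, [/\ 0 < d, 0 <= M &
  forall t, 0 < t < d -> w t <= M].
Proof.
have /ereal_inf_lt[_ [V V0 <-] Voo] := limsup_w.
have : nbhs (0 : R)^'+ V by [].
rewrite /at_right /within /= -nbhs_ballE => -[d /= d0 dV].
exists d, `|fine (ereal_sup ((fun t => (w t)%:E) @` V))|; split=> // t /andP[t0 td].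
have Vt : V t by apply: dV => //; rewrite /ball /= sub0r normrN gtr0_norm.
have : ((w t)%:E <= ereal_sup ((fun t => (w t)%:E) @` V))%E.
  by apply: ereal_sup_ubound; exists t.
move: Voo; case: (ereal_sup _) => [r _|//|//] /=.
by rewrite lee_fin => /le_trans; apply; exact: ler_norm.
Qed.

(** For small [t] the operators [T t - 1] are bounded by [M + 1], so weak continuity at 0 passes
    from the ranges of the semigroup to their norm closure. *)
Lemma X1_Xtilde x : X1 x -> Xtilde x.
Proof.
move=> Xx; split=> // l Xsl; apply/cvg_nrmP => e e0.
have [d [M [d0 M0 wM]]] := limsup_bounded.
have l0 := pairing_opnorm_ge0 hXs Xsl.
have k0 : 0 < opnorm setT l * (M + 1) + 1 by rewrite ltr_wpDl // mulr_ge0 // addr_ge0.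
have e3 : 0 < e / 2 by rewrite divr_gt0.
move/X1P : (Xx) => /(_ _ (divr_gt0 e3 k0))[s [z [s0 zx]]].
have [_ /(_ l Xsl)/cvg_nrmP/(_ _ e3) lz] := Xtilde_semigroup hXs hT z s0.
have t0 : \forall t \near (0 : R)^'+, 0 < t by exact: nbhs_right_gt.
have td : \forall t \near (0 : R)^'+, t < d by exact: nbhs_right_lt.
near=> t; have tp : 0 < t by near: t.
have lzt : nrm (l (T t (T s z) - T s z) - 0) < e / 2 by near: t.
have wt : w t <= M by apply: wM; rewrite tp /=; near: t.
rewrite subr0 in lzt.
have -> : T t x - x = (T t (T s z) - T s z) + ((T s z - x) - T t (T s z - x)).
  by rewrite (semigroup_linB hT) // opprB addrA subrKA addrC subrKA.
rewrite subr0 (pairingD hXs) // (le_lt_trans (nrmD _ _)) // [e]splitr ltrD //.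
rewrite (le_lt_trans (pairing_opnorm hXs Xsl _)) //.
apply: (@le_lt_trans _ _ (opnorm setT l * (M + 1) * nrm (T s z - x))).
  rewrite -mulrA ler_wpM2l // (le_trans (nrmD _ _)) // nrmN mulrDl mul1r addrC lerD //.
  by rewrite (le_trans (semigroup_opnorm hT _ tp)) // ler_wpM2r ?nrm_ge0.
apply: (@le_lt_trans _ _ ((opnorm setT l * (M + 1) + 1) * nrm (T s z - x))).
  by rewrite ler_wpM2r ?nrm_ge0 // lerDl.
by rewrite -ltr_pdivlMl // mulrC.
Unshelve. all: by end_near. Qed.

Section graph.
Context (u v : X -> X).
Hypotheses (hu : Arveson_ideal Xs T u) (hv : Omega Xs T v).
Local Notation G := (graph_tilde Xs T u v).

Lemma graph_tildeP x y : G (x, y) <-> [/\ X1 x, X1 y & u x = v y].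
Proof.
split=> [[/= [Xx _] [Xy _] uv]|[Xx Xy uv]]; first by split.
split=> //=; last exact: X1_Xtilde.
by split=> //; exists y; [exact: X1_Xtilde|rewrite uv].
Qed.

Lemma graph_tilde_partial_operator : partial_operator X1 G.
Proof.
have hv1 := hv.1.
split.
- by move=> [x y] /graph_tildeP[].
- apply/graph_tildeP; split; try exact: (X1_0 hT).
  by rewrite (bounded_operators0 (X1_0 hT) (arveson_bounded hu))
    (bounded_operators0 (X1_0 hT) (arveson_bounded hv1)).
- move=> a [x y] [x' y'] /graph_tildeP[Xx Xy uv] /graph_tildeP[Xx' Xy' uv'].
  apply/graph_tildeP; split; try exact: (X1_lin hT).
  have [_ lu _ _] := arveson_bounded hu; have [_ lv _ _] := arveson_bounded hv1.
  by rewrite lu // lv // uv uv'.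
move=> x y y' /graph_tildeP[Xx Xy uv] /graph_tildeP[_ Xy' uv'].
apply/eqP; rewrite -subr_eq0; apply/eqP; apply: (omega_injective hXs hT hv).
  by apply: X1_Xtilde; exact: (X1B hT).
by rewrite (bounded_operatorsB (X1_0 hT) (X1Z hT) (arveson_bounded hv1)) // -uv -uv' subrr.
Qed.

Lemma graph_tilde_closed : closed_in (X1 `*` X1) G.
Proof.
move=> [x y] [[/= Xx Xy] cG]; have hv1 := hv.1; apply/graph_tildeP; split=> //.
apply: (@nrm_small_eq _ _ _ _ (opnorm X1 u + opnorm X1 v)) => e e0.
have nx : nbhs x [set x' | nrm (x' - x) < e] by apply/nbhs_nrmP; exists e.
have ny : nbhs y [set y' | nrm (y' - y) < e] by apply/nbhs_nrmP; exists e.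
have nxy : nbhs (x, y) ([set x' | nrm (x' - x) < e] `*` [set y' | nrm (y' - y) < e]).
  by exists ([set x' | nrm (x' - x) < e], [set y' | nrm (y' - y) < e]).
have [[x' y'] [/graph_tildeP[Xx' Xy' uv'] [/= x'x y'y]]] := cG _ nxy.
rewrite (le_trans (nrm_triangle _ (u x') _)) // mulrDr lerD //.
  rewrite -(bounded_operatorsB (X1_0 hT) (X1Z hT) (arveson_bounded hu)) //.
  rewrite (le_trans (arveson_opnorm hT hu (X1B hT Xx Xx'))) // mulrC.
  by rewrite ler_wpM2r ?(arveson_opnorm_ge0 hT hu) // nrmB ltW.
rewrite uv' -(bounded_operatorsB (X1_0 hT) (X1Z hT) (arveson_bounded hv1)) //.
rewrite (le_trans (arveson_opnorm hT hv1 (X1B hT Xy' Xy))) // mulrC.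
by rewrite ler_wpM2r ?(arveson_opnorm_ge0 hT hv1) // ltW.
Qed.

End graph.
End bounded_semigroup.
(** * Invariance of the predual *)

Section norm_closedness.
Context {R : realType} {X : completeNormedModType R[i]}.
Local Notation C := R[i].
Context (Xs : set (functional X)).
Hypotheses (hXs : dual_pairing Xs) (hull : compact_hull_property Xs).

(** A neighbourhood of the limit takes care of a tail of the sequence; the finitely many other terms
    are added by induction. *)
Lemma compact_cvg_range (M : topologicalType) (k : nat -> M) (p : M) :
  k @ \oo --> p -> compact (p |` range k).
Proof.
move=> kp; apply/compact_near_coveringP => I F P FF h.
have [[A B] /= [Ap FB] AB] : \forall x' \near p & i \near F, P i x'.
  by apply: h; left.
have [N _ NA] : \forall n \near \oo, A (k n) by exact: kp.
have FN : forall n, \forall i \near F, forall m, (m < n)%N -> P i (k m).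
  elim=> [|n IH]; first by apply: nearW.
  have Pn : \forall i \near F, P i (k n).
    have [[A' B'] /= [A'n FB'] AB'] := h (k n) (or_intror (ex_intro2 _ _ n Logic.I erefl)).
    apply: filterS FB' => i Bi; apply: (AB' (k n, i)); split=> //=.
    exact: nbhs_singleton A'n.
  apply: filterS2 IH Pn => i Pi Pin m; rewrite ltnS leq_eqVlt => /orP[/eqP ->//|].
  exact: Pi.
apply: filterS2 FB (FN N) => i Bi PN x [->|[m _ <-]].
  by apply: (AB (p, i)); split=> //=; exact: nbhs_singleton Ap.
have [mN|Nm] := ltnP m N; first exact: PN.
by apply: (AB (k m, i)); split=> //=; exact: NA.
Qed.

Lemma convex_pairing : convex_set Xs.
Proof.
move=> x y a /set_mem Xx /set_mem Xy; apply/mem_set.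
apply: (dual_pairingP hXs _ Xx).
have := dual_pairingP hXs (1 - a%:inum) Xy (dual_pairing0 hXs).
by rewrite addr0.
Qed.

(* For functionals [l n] in [Xs] at distance at most [4 ^- n] from [m], the
   sequence [2 ^ (n + 1) (l (n + 1) - l n)] tends to [0], and the partial sums
   of its [2 ^- (n + 1)]-combination are [l n - l 0]. *)
Lemma pairing_norm_closed (m : X -> C^o) :
  (forall e : R, 0 < e -> exists2 l : X -> C^o, Xs l &
    forall x, nrm (l x - m x) <= e * nrm x) -> Xs m.
Proof.
move=> hm.
have q0 n : 0 < (4 ^- n : R) by rewrite invr_gt0 exprn_gt0.
have /choice[l hl] : forall n, exists l : X -> C^o,
    Xs l /\ forall x, nrm (l x - m x) <= 4 ^- n * nrm x.
  by move=> n; have [l Xsl ml] := hm _ (q0 n); exists l.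
have Xsub (a b : functional X) : Xs a -> Xs b -> Xs (a - b).
  by move=> Xa Xb; rewrite addrC -scaleN1r; apply: dual_pairingP.
have XZ (c : C) (a : functional X) : Xs a -> Xs (c *: a).
  by move=> Xa; have := dual_pairingP hXs c Xa (dual_pairing0 hXs); rewrite addr0.
pose k n : functional X := (2 ^+ n.+1)%:C *: ((l n.+1 : functional X) - l n).
have Xk n : Xs (k n) by apply: XZ; apply: Xsub; exact: (hl _).1.
have kE n x : k n x = (2 ^+ n.+1)%:C * (l n.+1 x - l n x) by [].
have k0 : k @ \oo --> (0 : functional X).
  apply/cvg_functionalP => x; apply/cvg_nrmP => e e0.
  (* Two consecutive functionals differ by at most [2 * 4 ^- n], and the factor [2 ^ (n + 1)] turns
     this into [4 * 2 ^- n]. *)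
  have kb n : nrm (k n x - 0 : C^o) <= 2 ^- n * (4 * nrm x).
    rewrite subr0 kE nrmM nrm_real ger0_norm ?exprn_ge0 //.
    have d : nrm (l n.+1 x - l n x) <= 4 ^- n * nrm x * 2.
      rewrite (le_trans (nrm_triangle _ (m x) _)) // mulr2n mulrDr mulr1 lerD //.
        rewrite (le_trans ((hl n.+1).2 x)) // ler_wpM2r ?nrm_ge0 //.
        by rewrite lef_pV2 ?posrE ?exprn_gt0 // exprS ler_peMl ?exprn_ge0 // ler1n.
      by rewrite nrmB; exact: (hl n).2.
    apply: (@le_trans _ _ (2 ^+ n.+1 * (4 ^- n * nrm x * 2))).
      by rewrite ler_wpM2l ?exprn_ge0.
    have -> : (4 : R) = 2 * 2 by rewrite -natrM.
    rewrite exprMn invfM exprS le_eqVlt; apply/orP; left; apply/eqP.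
    by field; rewrite expf_neq0.
  have lim0 : (fun n => 2 ^- n * (4 * nrm x) : R) @ \oo --> (0 : R).
    rewrite -[X in _ --> X](mul0r (4 * nrm x)); apply: cvgM (cvg_cst _).
    under eq_fun do rewrite -exprVn.
    by apply: cvg_expr; rewrite ger0_norm ?invf_lt1 ?ltr1n.
  have /cvgrPdist_lt/(_ e e0) := lim0; apply: filterS => n.
  rewrite sub0r normrN; apply: le_lt_trans; rewrite (le_trans (kb n)) // ler_norm //.
pose A : set (functional X) := 0 |` range k.
have AXs : A `<=` Xs by move=> _ [->|[n _ <-]]; [exact: dual_pairing0|exact: Xk].
have cA : compact A by exact: compact_cvg_range.
(* The last coefficient, [2 ^- n], falls on the point 0 of [A]: it completes the total to 1 without
   changing the sum. *)
pose c n i : R := if (i < n)%N then 2 ^- i.+1 else 2 ^- n.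
pose a n i : functional X := if (i < n)%N then k i else 0.
have sc n : \sum_(i < n.+1) c n i = 1.
  rewrite big_ord_recr /= {2}/c ltnn.
  under eq_bigr => i _ do rewrite /c ltn_ord.
  elim: n => [|n IH]; first by rewrite big_ord0 add0r expr0 invr1.
  rewrite big_ord_recr /= -[RHS]IH -addrA; congr (_ + _).
  by rewrite exprS; field; rewrite expf_neq0.
have sa n : \sum_(i < n.+1) (c n i)%:C *: a n i = (l n : functional X) - l 0%N.
  rewrite big_ord_recr /= {2}/a ltnn scaler0 addr0.
  under eq_bigr => i _ do rewrite /c /a ltn_ord.
  elim: n => [|n IH]; first by rewrite big_ord0 subrr.
  rewrite big_ord_recr /= IH /k scalerA -rmorphM /= mulVf ?expf_neq0 // scale1r.
  by rewrite addrC subrKA.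
have [|q Xq hq] := @hull_cluster R (functional X) Xs A
    (fun n => (l n : functional X) - l 0%N) convex_pairing hull AXs cA.
  move=> n H AH cvxH; rewrite -sa; apply: convex_combination => //.
  - by move=> i _; rewrite /c; case: ifP => _; rewrite invr_ge0 exprn_ge0.
  - move=> i _; rewrite /a; case: ifP => _; first by apply: AH; right.
    by apply: AH; left.
have qE x : q x = m x - l 0%N x.
  apply: (cluster_eval (@functional_eval_continuous _ _ x) hq).
  apply: cvgB; last exact: cvg_cst.
  apply/cvg_nrmP => e e0.
  have lim0 : (fun n => 4 ^- n * nrm x : R) @ \oo --> (0 : R).
    rewrite -[X in _ --> X](mul0r (nrm x)); apply: cvgM (cvg_cst _).
    under eq_fun do rewrite -exprVn.
    by apply: cvg_expr; rewrite ger0_norm ?invf_lt1 ?ltr1n.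
  have /cvgrPdist_lt/(_ e e0) := lim0; apply: filterS => n.
  rewrite sub0r normrN; apply: le_lt_trans.
  by rewrite (le_trans ((hl n).2 x)) // ler_norm.
have -> : m = 1 *: (q : functional X) + l 0%N.
  by apply/funext => x; rewrite scale1r -[RHS]/(q x + l 0%N x) qE subrK.
by apply: dual_pairingP => //; exact: (hl _).1.
Qed.

End norm_closedness.

(** * Pettis integrals of dual orbits *)

Section predual_invariance.
Context {R : realType} {X : completeNormedModType R[i]}.
Local Notation C := R[i].
Local Notation RT := (measurableTypeR R).
Local Notation mu := (@lebesgue_measure R).
Context (Xs : set (functional X)) (T : R -> X -> X).
Hypotheses (hXs : dual_pairing Xs) (hT : weak_semigroup Xs T).
Hypothesis hull : compact_hull_property Xs.
Local Notation w t := (opnorm setT (T t)).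
Local Notation D := (`]0, +oo[%classic : set RT).
Local Notation I a b := (`]a, b]%classic : set RT).

Let mD : measurable D. Proof. exact: measurable_itv. Qed.
Let mI a b : measurable (I a b). Proof. exact: measurable_itv. Qed.

Lemma dual_orbit_continuous (l : X -> C^o) (a : R) : Xs l -> 0 < a ->
  continuous (fun t => (l \o T (Num.max a t)) : functional X).
Proof.
move=> Xsl a0 t; apply/cvg_functionalP => x.
have := @orbit_continuous _ _ _ _ hT x a 0 a0 t.
move/cvg_weakP => /(_ l Xsl); rewrite subr0.
by under eq_fun do rewrite subr0.
Qed.

Lemma cintegrableD (E : set RT) (g h : R -> C) : measurable E ->
  cintegrable E g -> cintegrable E h -> cintegrable E (fun t => g t + h t).
Proof.
move=> mE [gR gI] [hR hI]; split.
  rewrite (_ : _ \o _ = EFin \o (fun t => Re (g t) + Re (h t))).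
    by have := @integrableD _ _ _ mu _ mE _ _ gR hR; exact.
  by apply/funext => t; rewrite /comp raddfD.
rewrite (_ : _ \o _ = EFin \o (fun t => Im (g t) + Im (h t))).
  by have := @integrableD _ _ _ mu _ mE _ _ gI hI; exact.
by apply/funext => t; rewrite /comp raddfD.
Qed.

Section weighted.
Context (a b K : R) (a0 : 0 < a) (ab : a < b).

Lemma bounded_weight_cintegrable (g : R -> C) (l : X -> C^o) x : Xs l ->
  cmeasurable_fun (I a b) g ->
  (forall t, a < t <= b -> nrm (g t : C^o) * w t <= K) ->
  cintegrable (I a b) (fun t => g t * l (T t x)).
Proof.
move=> Xsl mg gK.
have DI : I a b `<=` D.
  by move=> t; rewrite /= !in_itv /= andbT => /andP[/(lt_trans a0)].
have [kR kI] := orbit_cmeasurable hT x Xsl.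
apply: (@le_cintegrable _ _ (mI a b) _ (fun=> opnorm setT l * nrm x * K)).
- apply: cmeasurable_funM mg _.
  by split; [exact: measurable_funS kR|exact: measurable_funS kI].
- exact: integrable_cst_itv.
move=> t /=; rewrite in_itv /= => tab; have /andP[at_ _] := tab.
rewrite nrmM (@le_trans _ _ (nrm (g t : C^o) * (opnorm setT l * nrm x * w t))) //.
  rewrite ler_wpM2l ?nrm_ge0 //.
  exact: (orbit_bound hXs hT x Xsl (lt_trans a0 at_)).
by rewrite mulrCA ler_wpM2l ?gK // mulr_ge0 ?nrm_ge0 ?(pairing_opnorm_ge0 hXs Xsl).
Qed.

(** The dual orbit [l \o T t] is continuous for pointwise convergence. The Pettis integral is taken
    inside [Xs] by means of the hull property of [Xs], which is what gives membership. *)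
Lemma dual_integral_nonneg (f : R -> R) (l : X -> C^o) : Xs l ->
  measurable_fun (I a b) f -> (forall t, a < t <= b -> 0 <= f t <= K) ->
  Xs (fun x => cintegral (I a b) (fun t => (f t)%:C * l (T t x))).
Proof.
move=> Xsl mf fK.
have [||||q Xq lq] := @pettis_integral R (functional X) Xs
  (fun t => (l \o T (Num.max a t)) : functional X) a b f (convex_pairing hXs) hull
  (dual_orbit_continuous Xsl a0).
- move=> t; apply: (semigroup_pairing hT _ Xsl).
  by rewrite lt_max a0.
- exact: ab.
- apply: (@le_integrable _ _ _ mu _ (mI a b) _ (EFin \o (fun=> K))).
  + exact/measurable_EFinP.
  + move=> t /=; rewrite in_itv /= => /fK /andP[f0 f1].
    by rewrite lee_fin ger0_norm // (le_trans f1) // ler_norm.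
  + exact: integrable_cst_itv.
- by move=> t /fK/andP[].
have -> : (fun x => cintegral (I a b) (fun t => (f t)%:C * l (T t x))) =
    (\int[mu]_(t in I a b) f t)%:C *: (q : functional X).
  apply/funext => x.
  have lx : linear ((fun m : functional X => m x) : functional X -> C^o) by [].
  have := lq _ (@functional_eval_continuous _ _ x) lx.
  move=> qE; rewrite -[RHS]/((\int[mu]_(t in I a b) f t)%:C * q x) qE.
  apply: complex_eqP; rewrite /cintegral; cbn [complex.Re complex.Im];
    apply: eq_Rintegral => t; rewrite inE /= in_itv /= => /andP[/ltW at_ _];
    by rewrite ?Re_mul ?Im_mul /= mul0r ?subr0 ?addr0 max_r.
by have := dual_pairingP hXs (\int[mu]_(t in I a b) f t)%:C Xq (dual_pairing0 hXs); rewrite addr0.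
Qed.

(** Pettis integration asks for nonnegative weights, so [g] is split into the positive and negative
    parts of its real and imaginary parts. Of the two bounds, the first makes the weights
    integrable; the second makes the scalar integrands integrable, although [w] may be unbounded on
    []a, b]]. *)
Lemma dual_integral (g : R -> C) (l : X -> C^o) : Xs l ->
  cmeasurable_fun (I a b) g ->
  (forall t, a < t <= b -> nrm (g t : C^o) <= K) ->
  (forall t, a < t <= b -> nrm (g t : C^o) * w t <= K) ->
  Xs (fun x => cintegral (I a b) (fun t => g t * l (T t x))).
Proof.
move=> Xsl mg gK gwK; have [gR gI] := mg.
pose p (s : R) (h : R -> R) (t : R) := Num.max (s * h t) 0.
have mp s h : measurable_fun (I a b) h -> measurable_fun (I a b) (p s h).
  by move=> mh; apply: measurable_maxr => //; apply: measurable_funM.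
pose r1 := p 1 (fun t => Re (g t)); pose r2 := p (-1) (fun t => Re (g t)).
pose i1 := p 1 (fun t => Im (g t)); pose i2 := p (-1) (fun t => Im (g t)).
have pE (h : R -> R) t : h t = p 1 h t - p (-1) h t.
  by rewrite /p mul1r mulN1r /Num.max; case: ltP => ?; case: ltP => ?; lra.
have pb (h : R -> R) t s : `|s| = 1 -> 0 <= p s h t <= `|h t|.
  move=> s1; rewrite /p le_max lexx orbT /= ge_max normr_ge0 andbT.
  by rewrite (le_trans (ler_norm _)) // normrM s1 mul1r.
have n1 : `|1 : R| = 1 by rewrite normr1.
have nN1 : `|-1 : R| = 1 by rewrite normrN normr1.
have step (s : R) (h : R -> R) : `|s| = 1 -> measurable_fun (I a b) h ->
    (forall t, `|h t| <= nrm (g t : C^o)) ->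
    Xs (fun x => cintegral (I a b) (fun t => (p s h t)%:C * l (T t x))) /\
    forall x, cintegrable (I a b) (fun t => (p s h t)%:C * l (T t x)).
  move=> s1 mh hg; split.
    apply: dual_integral_nonneg => //; first exact: mp.
    move=> t tab; have /andP[-> ph] := pb h t s s1.
    by rewrite (le_trans ph) // (le_trans (hg t)) // gK.
  move=> x; apply: bounded_weight_cintegrable => //.
    by split; [exact: mp|exact: measurable_cst].
  move=> t tab; have /andP[p0 ph] := pb h t s s1.
  have /andP[at_ _] := tab.
  rewrite nrm_real ger0_norm // (le_trans _ (gwK t tab)) //.
  rewrite ler_wpM2r ?(semigroup_opnorm_ge0 hT (lt_trans a0 at_)) //.
  by rewrite (le_trans ph).
have hR t : `|Re (g t)| <= nrm (g t : C^o) by exact: normr_Re_le.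
have hI t : `|Im (g t)| <= nrm (g t : C^o) by exact: normr_Im_le.
have [X1' c1] := step 1 _ n1 gR hR; have [X2' c2] := step (-1) _ nN1 gR hR.
have [X3' c3] := step 1 _ n1 gI hI; have [X4' c4] := step (-1) _ nN1 gI hI.
pose J (h : R -> R) : functional X :=
  fun x => cintegral (I a b) (fun t => (h t)%:C * l (T t x)).
have -> : (fun x => cintegral (I a b) (fun t => g t * l (T t x))) =
    (* The coefficient 1 and the final 0 give the sum the shape [a *: l + m] at each level, ready
       for [dual_pairingP]. *)
    1 *: J r1 + ((-1) *: J r2 + ('i%C *: J i1 + ((- 'i%C) *: J i2 + 0))).
  apply/funext => x; rewrite addr0.
  have -> : cintegral (I a b) (fun t => g t * l (T t x)) =
    cintegral (I a b) (fun t => 1 * ((r1 t)%:C * l (T t x)) +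
     ((-1) * ((r2 t)%:C * l (T t x)) + ('i%C * ((i1 t)%:C * l (T t x)) +
      (- 'i%C) * ((i2 t)%:C * l (T t x))))).
    apply: eq_cintegral => t _; rewrite !mulrA -!mulrDl; congr (_ * _).
    apply: complex_eqP; rewrite !raddfD /= ?Re_mul ?Im_mul /=.
      by rewrite {1}(pE (fun t => Re (g t)) t) /r1 /r2; ring.
    by rewrite {1}(pE (fun t => Im (g t)) t) /i1 /i2; ring.
  have z1 := cintegrableZ 1 (mI a b) (c1 x).
  have z2 := cintegrableZ (-1) (mI a b) (c2 x).
  have z3 := cintegrableZ 'i%C (mI a b) (c3 x).
  have z4 := cintegrableZ (- 'i%C) (mI a b) (c4 x).
  have z34 := cintegrableD (mI a b) z3 z4.
  have z234 := cintegrableD (mI a b) z2 z34.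
  rewrite (cintegralD (mI a b) z1 z234) (cintegralD (mI a b) z2 z34).
  rewrite (cintegralD (mI a b) z3 z4) (cintegralZ (mI a b) 1 (c1 x)).
  rewrite (cintegralZ (mI a b) (-1) (c2 x)) (cintegralZ (mI a b) 'i%C (c3 x)).
  by rewrite (cintegralZ (mI a b) (- 'i%C) (c4 x)).
do 3 (apply: dual_pairingP => //).
by apply: dual_pairingP => //; exact: dual_pairing0.
Qed.

End weighted.

End predual_invariance.

(** * Action of the Arveson ideal on the predual *)

Section phi_predual.
Context {R : realType} {X : completeNormedModType R[i]}.
Local Notation C := R[i].
Local Notation RT := (measurableTypeR R).
Local Notation mu := (@lebesgue_measure R).
Context (Xs : set (functional X)) (T : R -> X -> X).
Hypotheses (hXs : dual_pairing Xs) (hT : weak_semigroup Xs T).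
Hypothesis hull : compact_hull_property Xs.
Local Notation w t := (opnorm setT (T t)).
Local Notation D := (`]0, +oo[%classic : set RT).
Local Notation I a b := (`]a, b]%classic : set RT).

Let mD : measurable D. Proof. exact: measurable_itv. Qed.
Let mI a b : measurable (I a b). Proof. exact: measurable_itv. Qed.

Section truncation.
Context (f : R -> C) (Lf : L1omega T f).

Let h (t : R) := nrm (f t : C^o) * w t.

(* [f] has to be truncated as well as its domain: it need not be integrable on
   compact intervals, as [w] may vanish there. *)
Definition truncation_set (n : nat) : set RT :=
  I n.+1%:R^-1 n.+1%:R `&`
  ((D `&` (fun t => nrm (f t : C^o)) @^-1` `]-oo, n.+1%:R]) `&`
   (D `&` (fun t => w t) @^-1` `]-oo, n.+1%:R])).
Local Notation G := truncation_set.

Lemma truncation_measurable n : measurable (G n).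
Proof.
apply: measurableI => //; apply: measurableI.
  have mn := measurable_nrm (L1omega_cmeasurable Lf).
  by apply: mn => //; exact: measurable_itv.
have mw := semigroup_opnorm_measurable hXs hT.
by apply: mw => //; exact: measurable_itv.
Qed.

Lemma truncation_bound n t : G n t ->
  [/\ n.+1%:R^-1 < t <= n.+1%:R, nrm (f t : C^o) <= n.+1%:R & w t <= n.+1%:R].
Proof. by move=> [tI [[_ fn] [_ wn]]]; move: tI fn wn; rewrite /= !in_itv /=. Qed.

Lemma truncation_eventually t : 0 < t -> \forall n \near \oo, G n t.
Proof.
move=> t0.
pose N := (Num.bound t^-1 + Num.bound t + Num.bound (nrm (f t : C^o)) + Num.bound (w t))%N.
exists N => // n /= Nn.
have bn (x : R) : 0 <= x -> (Num.bound x <= N)%N -> x <= n.+1%:R.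
  move=> /archi_boundP xb bN; rewrite (le_trans (ltW xb)) // ler_nat.
  by rewrite (leq_trans bN) // (leq_trans Nn).
have N1 : (Num.bound t^-1 <= N)%N by rewrite /N -!addnA leq_addr.
have tV : t^-1 < n.+1%:R.
  have /archi_boundP tb : 0 <= t^-1 by rewrite invr_ge0 ltW.
  by rewrite (lt_le_trans tb) // ler_nat (leq_trans N1) // (leq_trans Nn).
have tD : D t by rewrite /= in_itv /= t0.
split; first rewrite /= in_itv /=; last split; try split => //=; rewrite ?in_itv /=.
- rewrite invf_plt ?posrE ?ltr0Sn // tV /=; apply: bn; first exact: ltW.
  by rewrite /N -!addnA; exact: leq_trans (leq_addr _ _) (leq_addl _ _).
- apply: bn; [exact: nrm_ge0|rewrite /N -!addnA].
  exact: leq_trans (leq_trans (leq_addr _ _) (leq_addl _ _)) (leq_addl _ _).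
- by apply: bn; [exact: (semigroup_opnorm_ge0 hT t0)|rewrite /N leq_addl].
Qed.

Lemma truncation_weight_ge0 t : D t -> 0 <= h t.
Proof.
rewrite /= in_itv /= andbT => t0.
by rewrite mulr_ge0 ?nrm_ge0 // (semigroup_opnorm_ge0 hT t0).
Qed.

Lemma truncation_weight_integrable : mu.-integrable D (EFin \o h).
Proof.
have := L1omega_integrable hXs hT Lf 1.
by rewrite (_ : (fun t => 1 * _) = h) //; apply/funext => t; rewrite mul1r.
Qed.

Lemma truncation_rest_measurable n :
  measurable_fun D (fun t => h t * (1 - \1_(G n) t)).
Proof.
have mh : measurable_fun D h.
  by apply/measurable_EFinP; exact: measurable_int truncation_weight_integrable.
apply: measurable_funM => //.
by apply: measurable_funB => //; apply: measurable_indic; exact: truncation_measurable.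
Qed.

Lemma truncation_rest_bound n t : D t -> 0 <= h t * (1 - \1_(G n) t) <= h t.
Proof.
move=> Dt; have ht := truncation_weight_ge0 Dt; rewrite indicE.
by case: (t \in _); rewrite ?subrr ?subr0 ?mulr0 ?mulr1 ?lexx ?ht.
Qed.

Lemma truncation_rest_integrable n :
  mu.-integrable D (EFin \o (fun t => h t * (1 - \1_(G n) t))).
Proof.
apply: (@le_integrable _ _ _ mu _ mD _ (EFin \o h)).
- by apply/measurable_EFinP; exact: truncation_rest_measurable.
- move=> t Dt; have /andP[r0 rh] := truncation_rest_bound n Dt.
  by rewrite /= lee_fin ger0_norm // (le_trans rh) // ler_norm.
- exact: truncation_weight_integrable.
Qed.

Lemma truncation_cvg :
  \int[mu]_(t in D) (h t * (1 - \1_(G n) t)) @[n --> \oo] --> (0 : R).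
Proof.
have lim : (\int[mu]_(t in D) (h t * (1 - \1_(G n) t))%:E)%E @[n --> \oo] --> 0%E.
  have := @dominated_convergence _ RT R mu D mD
    (fun n t => (h t * (1 - \1_(G n) t))%:E) (cst 0%E) (EFin \o h).
  rewrite integral0; case => //.
  - by move=> n; apply/measurable_EFinP; exact: truncation_rest_measurable.
  - apply: aeW => t /=; rewrite in_itv /= andbT => t0.
    apply: cvg_near_cst; apply: filterS (truncation_eventually t0) => n Gt.
    by rewrite indicE mem_set // subrr mulr0.
  - exact: truncation_weight_integrable.
  - apply: aeW => t n Dt; have /andP[r0 rh] := truncation_rest_bound n Dt.
    by rewrite /= lee_fin ger0_norm.
by have /fine_cvgP[] := lim.
Qed.

(** Truncating [f] changes [l \o A] by at most [2 * opnorm setT l] times the integral of the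
    discarded part of [h], which tends to 0. Hence [l \o A] is a norm limit of functionals supplied
    by [dual_integral]. *)
Lemma phi_pairing (A : X -> X) (l : X -> C^o) : is_phi Xs T f A -> Xs l -> Xs (l \o A).
Proof.
move=> [_ fA] Xsl; apply: (pairing_norm_closed hXs hull) => e e0.
have l0 := pairing_opnorm_ge0 hXs Xsl.
have c0 : 0 < 2 * opnorm setT l + 1 by rewrite ltr_wpDl // mulr_ge0.
have /cvgrPdist_lt/(_ _ (divr_gt0 e0 c0))[n _ /(_ n (leqnn n))] := truncation_cvg.
rewrite /= sub0r normrN => /(le_lt_trans (ler_norm _)) small.
(* The right end is [n + 2] instead of [n + 1] so that [a < b] also holds for [n = 0]. *)
pose a : R := n.+1%:R^-1; pose b : R := n.+2%:R.
have a0 : 0 < a by rewrite invr_gt0.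
have ab : a < b.
  rewrite (@le_lt_trans _ _ 1) ?ltr1n // invf_le1 ?ltr0Sn // ler1n //.
pose g t : C := (\1_(G n) t)%:C * f t.
have mG : measurable_fun D (\1_(G n) : RT -> R).
  by apply: measurable_indic; exact: truncation_measurable.
have mg : cmeasurable_fun D g.
  apply: cmeasurable_funM (L1omega_cmeasurable Lf).
  by split => //; exact: measurable_cst.
have DI : I a b `<=` D.
  by move=> t; rewrite /= !in_itv /= andbT => /andP[/(lt_trans a0)].
have gE t : nrm (g t : C^o) = if t \in G n then nrm (f t : C^o) else 0.
  rewrite /g indicE; case: ifP => _; first by rewrite mul1r.
  by rewrite mul0r nrm0.
have n1 : (1 : R) <= n.+1%:R by rewrite ler1n.
exists (fun x => cintegral (I a b) (fun t => g t * l (T t x))).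
  (* On the truncation set [f] and [w] are at most [n + 1], so the square bounds both the product
     and [f] alone. *)
  apply: (@dual_integral _ _ _ _ hXs hT hull a b (n.+1%:R * n.+1%:R)) => //.
  - by case: mg => gR gI; split; [exact: measurable_funS gR|exact: measurable_funS gI].
  - move=> t _; rewrite gE; case: ifP => [|_]; last by rewrite mulr_ge0.
    rewrite inE => /truncation_bound[_ fn _].
    by rewrite (le_trans fn) // ler_peMl.
  - move=> t _; rewrite gE; case: ifP => [|_]; last by rewrite mul0r mulr_ge0.
    rewrite inE => /truncation_bound[/andP[tn _] fn wn].
    have t0 : 0 < t by exact: lt_trans a0 tn.
    by apply: ler_pM; rewrite ?nrm_ge0 // (semigroup_opnorm_ge0 hT t0).
move=> x; rewrite /= (fA x l Xsl).
pose k t := l (T t x).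
(* This is [g - f]: adding [f] back writes the truncated integral as a sum of two convergent
   integrals over [D]. *)
pose f' t : C := (\1_(G n) t - 1)%:C * f t.
have nf' t : nrm (f' t : C^o) = nrm (f t : C^o) * (1 - \1_(G n) t).
  rewrite /f' nrmM nrm_real indicE.
  case: (t \in _); first by rewrite !subrr normr0 mul0r mulr0.
  by rewrite sub0r subr0 normrN normr1 mul1r mulr1.
have mf' : cmeasurable_fun D (fun t => f' t * k t).
  apply: cmeasurable_funM (orbit_cmeasurable hT x Xsl).
  apply: cmeasurable_funM (L1omega_cmeasurable Lf).
  by split; [exact: measurable_funB|exact: measurable_cst].
pose v t := opnorm setT l * nrm x * (h t * (1 - \1_(G n) t)).
have iv : mu.-integrable D (EFin \o v).
  have := @integrableZl _ _ _ mu D mD (opnorm setT l * nrm x) _ (truncation_rest_integrable n).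
  exact.
have fv t : D t -> nrm (f' t * k t : C^o) <= v t.
  rewrite /= in_itv /= andbT => t0; rewrite nrmM nf' /v /h.
  have s0 : 0 <= 1 - \1_(G n) t :> R by rewrite indicE; case: (t \in _); rewrite ?subrr ?subr0.
  apply: (@le_trans _ _ (nrm (f t : C^o) * (1 - \1_(G n) t) * (opnorm setT l * nrm x * w t))).
    by rewrite ler_wpM2l ?mulr_ge0 ?nrm_ge0 // (orbit_bound hXs hT x Xsl t0).
  by rewrite le_eqVlt; apply/orP; left; apply/eqP; ring.
have if' := le_cintegrable mD mf' iv fv.
have ifk := phi_cintegrable hXs hT Lf x Xsl.
have -> : cintegral (I a b) (fun t => g t * l (T t x)) =
    cintegral D (fun t => f' t * k t + f t * l (T t x)).
  rewrite -cintegral_indicator //; apply: eq_cintegral => t Dt.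
  rewrite -mulrDl /indicator /f' /g mulrA; congr (_ * _).
  have -> : (\1_(G n) t - 1)%:C * f t + f t = (\1_(G n) t)%:C * f t.
    by rewrite rmorphB /= mulrBl mul1r subrK.
  rewrite mulrA; congr (_ * _); rewrite !indicE.
  case: (boolP (t \in G n)) => [|_]; last by rewrite mulr0.
  rewrite inE => /truncation_bound[/andP[t1 t2] _ _].
  rewrite mem_set ?mul1r //= in_itv /= t1 (le_trans t2) // ler_nat //.
rewrite (cintegralD mD if' ifk) addrK.
apply: (le_trans (nrm_cintegral_le mD mf' iv fv)).
rewrite (RintegralZl _ mD (truncation_rest_integrable n)).
apply: (@le_trans _ _ ((2 * opnorm setT l + 1) * (e / (2 * opnorm setT l + 1)) * nrm x)).
  rewrite [leLHS](_ : _ = 2 * opnorm setT l *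
    (\int[mu]_(t in D) (h t * (1 - \1_(G n) t))) * nrm x); last by ring.
  rewrite ler_wpM2r ?nrm_ge0 //; apply: ler_pM.
  - by rewrite mulr_ge0.
  - by apply: Rintegral_ge0 => t Dt; have /andP[] := truncation_rest_bound n Dt.
  - by rewrite lerDl.
  - exact: ltW.
by rewrite mulrCA mulfV ?gt_eqF // mulr1.
Qed.

End truncation.
Local Notation X1 := (X1 T).

(** The factor [T s] maps [X] into [X1], the only place where [u] is linear and close to an operator
    [phi(f)]. *)
Lemma arveson_pairing u s (l : X -> C^o) : Arveson_ideal Xs T u -> 0 < s -> Xs l ->
  Xs (fun x => l (u (T s x))).
Proof.
move=> hu s0 Xsl; apply: (pairing_norm_closed hXs hull) => e e0.
have l0 := pairing_opnorm_ge0 hXs Xsl; have w0 := semigroup_opnorm_ge0 hT s0.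
have c0 : 0 < opnorm setT l * w s + 1 by rewrite ltr_wpDl // mulr_ge0.
have [f [A [Lf fA uA]]] := arveson_approx hXs hT hu (divr_gt0 e0 c0).
exists (fun x => l (A (T s x))).
  exact: (semigroup_pairing hT s0 (phi_pairing Lf fA Xsl)).
move=> x; rewrite -(pairingB hXs) // (le_trans (pairing_opnorm hXs Xsl _)) //.
have Xx : X1 (T s x) by exact: X1_semigroup.
apply: (@le_trans _ _ (opnorm setT l * (e / (opnorm setT l * w s + 1) * (w s * nrm x)))).
  rewrite ler_wpM2l // nrmB (le_trans (uA _ Xx)) // ler_wpM2l ?(ltW (divr_gt0 e0 c0)) //.
  exact: (semigroup_opnorm hT x s0).
apply: (@le_trans _ _ (e / (opnorm setT l * w s + 1) * (opnorm setT l * w s + 1) * nrm x)).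
  rewrite [leLHS](_ : _ = e / (opnorm setT l * w s + 1) * (opnorm setT l * w s) * nrm x);
    last by ring.
  by rewrite ler_wpM2r ?nrm_ge0 // ler_wpM2l ?(ltW (divr_gt0 e0 c0)) // lerDl.
by rewrite divfK // gt_eqF.
Qed.

(** Weakly continuous functionals [m1] and [m2] satisfy [m1 x' = m2 y'] on the graph, hence also on
    its weak closure, which gives [T s (u x - v y) = 0] for all [s > 0]. Boundedness near 0 puts
    [u x - v y] in [Xtilde], where [orbit_null] removes [T s]. *)
Lemma graph_tilde_weakly_closed u v :
  (limf_esup (fun t => (w t)%:E) 0^'+ < +oo)%E ->
  Arveson_ideal Xs T u -> Omega Xs T v ->
  closed_in (X1 `*` X1 : set (weak Xs * weak Xs)) (graph_tilde Xs T u v).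
Proof.
move=> hw hu hv [x y] [[/= Xx Xy] cG]; have hv1 := hv.1.
apply/(graph_tildeP hXs hT hw u v x y); split=> //.
have Xu := arveson_X1 hu Xx; have Xv := arveson_X1 hv1 Xy.
have Ts0 s : 0 < s -> T s (u x - v y) = 0.
  move=> s0; apply: (pairing_sep hXs) => l Xsl.
  rewrite (pairing0 hXs Xsl) (semigroup_linB hT) // (pairingB hXs) //.
  rewrite -(arveson_semigroup hXs hT hu s0 Xx) -(arveson_semigroup hXs hT hv1 s0 Xy).
  pose m1 : X -> C^o := fun z => l (u (T s z)).
  pose m2 : X -> C^o := fun z => l (v (T s z)).
  have c1 := weak_eval_continuous (arveson_pairing hu s0 Xsl).
  have c2 := weak_eval_continuous (arveson_pairing hv1 s0 Xsl).
  rewrite -[l (u _)]/(m1 x) -[l (v _)]/(m2 y).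
  apply: (@nrm_small_eq _ C^o _ _ 1) => e e0; rewrite mulr1 subr0.
  have e2 : 0 < e / 2 by rewrite divr_gt0.
  have /cvg_nrmP/(_ _ e2) n1 := c1 x; have /cvg_nrmP/(_ _ e2) n2 := c2 y.
  pose B1 : set (weak Xs) := [set z : X | nrm (m1 z - m1 x) < e / 2].
  pose B2 : set (weak Xs) := [set z : X | nrm (m2 z - m2 y) < e / 2].
  have nB : nbhs ((x, y) : weak Xs * weak Xs) (B1 `*` B2) by exists (B1, B2).
  have [[x' y'] [/(graph_tildeP hXs hT hw u v x' y')[Xx' Xy' uv'] [/= x'x y'y]]] := cG _ nB.
  have m12 : m1 x' = m2 y'.
    rewrite /m1 /m2 (arveson_semigroup hXs hT hu s0 Xx').
    by rewrite (arveson_semigroup hXs hT hv1 s0 Xy') uv'.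
  rewrite (le_trans (nrm_triangle _ (m1 x') _)) // [e]splitr lerD //.
    by rewrite nrmB ltW.
  by rewrite m12 ltW.
apply/eqP; rewrite -subr_eq0; apply/eqP; apply: (orbit_null hXs hT).
  move=> d d0; exists (d / 2); last by apply: Ts0; rewrite divr_gt0.
  by apply/andP; split; lra.
by apply: (X1_Xtilde hXs hT hw); exact: (X1B hT).
Qed.

End phi_predual.

(** * Extension of quasimultipliers to partially defined operators on [X1] *)

Theorem proposition6p2 (R : realType) (X : completeNormedModType R[i])
    (Xs : set (functional X)) (T : R -> X -> X)
    (hXs : dual_pairing Xs) (hT : weak_semigroup Xs T)
    (S : set ((X -> X) * (X -> X))) (u v : X -> X)
    (hS : QM Xs T S)
    (hu : Arveson_ideal Xs T u) (hv : Omega Xs T v)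
    (hSuv : S = quasimultiplier Xs T u v) :
  [/\ forall x, dom_tilde Xs T u v x ->
        exists! y, Xtilde Xs T y /\ u x = v y,
      X1 T `<=` closure (dom_tilde Xs T u v : set (weak Xs)) &
      (limf_esup (fun t => (opnorm setT (T t))%:E) 0^'+ < +oo)%E ->
      [/\ partial_operator (X1 T) (graph_tilde Xs T u v),
          closed_in (X1 T `*` X1 T) (graph_tilde Xs T u v) &
          compact_hull_property Xs ->
          closed_in (X1 T `*` X1 T : set (weak Xs * weak Xs))
            (graph_tilde Xs T u v)]].
Proof.
split=> [x [Xx [y ty vy]]||hw].
- exists y; split=> // z [tz uz].
  apply/eqP; rewrite -subr_eq0; apply/eqP.
  have [Xy ly] := ty; have [Xz lz] := tz.
  apply: (omega_injective hXs hT hv); last first.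
    rewrite (bounded_operatorsB (X1_0 hT) (X1Z hT) (arveson_bounded hv.1)) //.
    by rewrite vy uz subrr.
  (* No bound near 0 is available at this point, so [y - z] is shown to lie in [Xtilde] by
     subtracting the two limits. *)
  split=> [|l Xsl]; first exact: (X1B hT).
  rewrite -(subrr (0 : R[i]^o)).
  apply: cvg_trans (cvgB (ly l Xsl) (lz l Xsl)); apply: near_eq_cvg.
  have t0 : \forall t \near (0 : R)^'+, 0 < t by exact: nbhs_right_gt.
  apply: filterS t0 => t t0 /=; rewrite (semigroup_linB hT) //.
  rewrite -[LHS]/(l (T t y - y) - l (T t z - z)) -(pairingB hXs) //; congr l.
  by rewrite !opprB addrACA [in RHS]addrACA; congr (_ + _); rewrite addrC.
- exact: dom_tilde_dense.
split.
- exact: graph_tilde_partial_operator.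
- exact: graph_tilde_closed.
by move=> hull; exact: graph_tilde_weakly_closed.
Qed.
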